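(* Let $n\ge1$. If there exists a Morin map $\mathbb{RP}^n\to\mathbb{R}^{n+k}$, then $k\ge\kappa(n)-1$, where $\kappa(n)$ is the integer defined in the context.
   Context: A Morin map is a smooth map $f$ without $\Sigma^2$-points (closure taken), i.e. with $\dim\ker(d_xf)\le1$ at every point $x$. Definition of $\kappa(n)$. Let $n$ have $t$ binary digits, $2^{t-1}\le n<2^t$, and let $L(t)=\lfloor 2^{t+1}/3\rfloor$ (the largest $t$-digit binary number without two consecutive $1$'s). Exactly one case holds: a) no consecutive $1$'s in the binary expansion of $n$, $n$ even; b) no consecutive $1$'s, $n$ odd; c) there are consecutive $1$'s and $n>L(t)$; d) there are consecutive $1$'s and $n<L(t)$. In case d) let $u$ be the largest integer such that $n=2^u(8a+3)+b$ with $0\le b<2^u$ (binary expansion $[a][0,1,1][b]$); then $a$ has no consecutive $1$'s. With $2^p$ the largest power of 2 dividing $n$: $\kappa(n)=\frac{n-2^p}{2}+1$ in case a); $\frac{n-1}{2}$ in case b); $2^t-n-1$ in case c); $2^{u+2}a+(2^u-1-b)$ in case d). *)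

(* Defs.v *)
From HB Require Import structures.
From mathcomp Require Import all_boot all_order all_algebra.
From mathcomp Require Import all_classical all_reals all_analysis.

Set Implicit Arguments.
Unset Strict Implicit.
Unset Printing Implicit Defensive.

Import Order.TTheory GRing.Theory Num.Theory.
Import numFieldNormedType.Exports.

Local Open Scope ring_scope.

Definition partials (R : realType) (n m : nat) (s : seq 'I_n)
    (g : 'rV[R]_n -> 'rV[R]_m) : 'rV[R]_n -> 'rV[R]_m :=
  foldr (fun i h => 'D_(delta_mx 0 i) h) g s.

(* 'D_v is a junk value where the directional derivative does not exist,
   hence the explicit derivability requirement at every order. *)
Definition smooth (R : realType) (n m : nat)
    (g : 'rV[R]_n -> 'rV[R]_m) : Prop :=
  forall s : seq 'I_n, continuous (partials s g) /\
    forall (x : 'rV[R]_n) (i : 'I_n),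
      derivable (partials s g) x (delta_mx 0 i).

Definition RP (R : realType) (n : nat) : Type :=
  {U : {vspace 'rV[R]_n.+1} | \dim U == 1%N}.

(* (y_1 : ... : 1 : ... : y_n), with the entry 1 in position i *)
Definition affine_vec (R : realType) (n : nat) (i : 'I_n.+1)
    (y : 'rV[R]_n) : 'rV[R]_n.+1 :=
  \row_j (if unlift i j is Some k then y 0 k else 1).

Lemma affine_vec_neq0 (R : realType) (n : nat) (i : 'I_n.+1) (y : 'rV[R]_n) :
  affine_vec i y != 0.
Proof.
apply/eqP => /rowP/(_ i); rewrite !mxE unlift_none => /eqP.
by rewrite oner_eq0.
Qed.

Lemma dim_affine_line (R : realType) (n : nat) (i : 'I_n.+1) (y : 'rV[R]_n) :
  \dim <[affine_vec i y]>%VS == 1%N.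
Proof. by rewrite dim_vline affine_vec_neq0. Qed.

(* The inverse of the i-th standard affine chart, a bijection from R^n onto
   the open set of lines on which the i-th coordinate does not vanish. *)
Definition rp_param (R : realType) (n : nat) (i : 'I_n.+1)
    (y : 'rV[R]_n) : RP R n :=
  exist _ <[affine_vec i y]>%VS (dim_affine_line i y).

Lemma rp_param_inj (R : realType) (n : nat) (i : 'I_n.+1) :
  injective (@rp_param R n i).
Proof.
move=> y z /(congr1 val) /= e.
have /vlineP[c yE] : affine_vec i y \in <[affine_vec i z]>%VS.
  by rewrite -e memv_line.
have c1 : c = 1.
  by have /rowP/(_ i) := yE; rewrite !mxE unlift_none mulr1.
apply/rowP => k; have /rowP/(_ (lift i k)) := yE.
by rewrite c1 scale1r !mxE liftK.
Qed.

Lemma rp_param_cover (R : realType) (n : nat) (L : RP R n) :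
  exists (i : 'I_n.+1) (y : 'rV[R]_n), L = rp_param i y.
Proof.
case: L => U dimU.
have U0 : U != 0%VS by rewrite -dimv_eq0 (eqP dimU).
have v0 : vpick U != 0 by rewrite vpick0.
have [i vi] : exists i, vpick U 0 i != 0.
  apply/existsP; apply: contraNT v0; rewrite negb_exists => /forallP h.
  by apply/eqP/rowP => j; rewrite mxE; apply/eqP; have := h j; rewrite negbK.
exists i, (\row_k (vpick U 0 (lift i k) / vpick U 0 i)).
apply: val_inj => /=; apply/esym/eqP; rewrite eqEdim; apply/andP; split; last first.
  by rewrite (eqP dimU) (eqP (dim_affine_line _ _)).
rewrite -memvE.
have -> : affine_vec i (\row_k (vpick U 0 (lift i k) / vpick U 0 i)) =
          (vpick U 0 i)^-1 *: vpick U.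
  apply/rowP => j; rewrite !mxE; case: unliftP => [k ->|->].
    by rewrite mxE mulrC.
  by rewrite mulVf.
exact/memvZ/memv_pick.
Qed.

Definition smooth_rp (R : realType) (n m : nat)
    (f : RP R n -> 'rV[R]_m) : Prop :=
  forall i : 'I_n.+1, smooth (f \o rp_param i).

(* dim ker (d_x f) is read off in every affine chart around x. *)
Definition Morin (R : realType) (n m : nat)
    (f : RP R n -> 'rV[R]_m) : Prop :=
  smooth_rp f /\
  forall (x : RP R n) (i : 'I_n.+1) (y : 'rV[R]_n), x = rp_param i y ->
    (\dim (lker (linfun ('d (f \o rp_param i) y))) <= 1)%N.

Local Open Scope nat_scope.

Definition ndigits (n : nat) : nat := (trunc_log 2 n).+1.

Lemma ndigitsP (n : nat) : 0 < n -> 2 ^ (ndigits n).-1 <= n < 2 ^ ndigits n.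
Proof. by move=> n0; exact: trunc_log_bounds. Qed.

Definition bit (n i : nat) : bool := odd (n %/ 2 ^ i).

Definition consecutive_ones (n : nat) : bool :=
  [exists i : 'I_n, bit n i && bit n i.+1].

Definition maxsparse (t : nat) : nat := 2 ^ t.+1 %/ 3.

(* n = 2^u (8 a + 3) + b with b < 2^u iff (n / 2^u) mod 8 = 3, and then
   a = n / 2^(u+3) and b = n mod 2^u; see block011P. *)
Definition block011 (n u : nat) : bool := (n %/ 2 ^ u) %% 8 == 3.

Lemma block011P (n u a b : nat) : b < 2 ^ u ->
  n = 2 ^ u * (8 * a + 3) + b <->
  [/\ block011 n u, a = n %/ 2 ^ (u + 3) & b = n %% 2 ^ u].
Proof.
move=> bu; have u0 : 0 < 2 ^ u by rewrite expn_gt0.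
rewrite /block011 expnD divnMA; split=> [->|[/eqP h -> ->]].
  have q : (2 ^ u * (8 * a + 3) + b) %/ 2 ^ u = 8 * a + 3.
    by rewrite mulnC divnMDl // divn_small // addn0.
  rewrite q (mulnC 8) modnMDl divnMDl // addn0.
  by split=> //; rewrite (mulnC (2 ^ u)) modnMDl modn_small.
rewrite [LHS](divn_eq n (2 ^ u)) [n %/ 2 ^ u in LHS](divn_eq _ 8) h.
by rewrite mulnC -[2 ^ 3]/8 (mulnC 8).
Qed.

Definition top011 (n : nat) : nat := \max_(u < n | block011 n u) u.

(* All subtractions are exact for n >= 1. *)
Definition kappa (n : nat) : nat :=
  let t := ndigits n in
  if ~~ consecutive_ones n then
    if ~~ odd n then (n - 2 ^ logn 2 n) %/ 2 + 1
    else (n - 1) %/ 2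
  else if maxsparse t < n then 2 ^ t - n - 1
  else
    let u := top011 n in
    2 ^ (u + 2) * (n %/ 2 ^ (u + 3)) + (2 ^ u - 1 - n %% 2 ^ u).

(* Main.v *)
Require Import Defs.
From mathcomp Require Import all_boot all_order all_algebra.
From mathcomp Require Import all_classical all_reals all_analysis.
From mathcomp Require Import zify ring lra.
Import Order.TTheory GRing.Theory Num.Theory.
Import numFieldNormedType.Exports.
Set Implicit Arguments.
Unset Strict Implicit.
Unset Printing Implicit Defensive.
Local Open Scope classical_set_scope.
Local Open Scope ring_scope.

(** Let f be a Morin map from RP^n to R^m and let F(x) = f([x]) be its
    homogeneous lift, defined for nonzero x in R^(n+1).  The linear map
    A(x) : u |-> (D_u F(x), <x, u>) from R^(n+1) to R^(m+1) has a kernel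
    isomorphic to that of df at [x], hence of dimension at most 1; moreover A(x)u
    is odd in x and odd in u ([augmented_diffN], [augmented_diff_oppr]).  So the
    2m+3 real equations

      A(x)u = 0,   A(x)v = 0,   <u, v> = 0

    have no solution with x, u, v all nonzero ([Morin_kernel]).  On the other
    hand each of these equations is even or odd in each of the three variables,
    and such a system on S^n x S^n x S^n is governed by a mod 2 characteristic
    class: writing x0, x1, x2 for the sign characters of the three variables,
    the product of the classes of the equations is
    (x0 + x1)^(m+1) (x0 + x2)^(m+1) (x1 + x2) in F_2[x0, x1, x2], and if the
    coefficient of some x0^a x1^b x2^c with a, b, c <= n is 1, then there is a
    solution ([product_borsuk_ulam]).  Repeating equations, m + 1 may be replaced
    by any larger M, and for M = n + kappa(n) - 1 a suitable monomial is found by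
    looking at binary digits ([admissible_kappa]).  So m + 1 > n + kappa(n) - 1,
    which is the claim.  (The bound for n = 1 only says that m >= 0.)

    The Borsuk-Ulam statement is proved by counting.  The boundary of a large
    cube, cut into unit cubes, is a sphere with a cell structure invariant under
    the antipode, and it carries hemispheres h_d with boundary h_(d-1) plus its
    antipode.  The sign s_j of the j-th function is recorded at the centre of
    each cell of a product of three such spheres.  For a cell K of dimension N
    let W(K) be the number mod 2 of flags K = K_0 > K_1 > ... > K_N of cells, each
    of codimension 1 in the previous one, such that s_j changes between K_(j-1)
    and K_j for all j; this is the value on K of a cup product of the 1-cocycles
    that record the sign changes.  As the boundary of a boundary is 0, the factor
    s_j at the top of a flag cancels ([flags_cons]), so that the sum of W over a
    chain only depends on the boundary of the chain; for h_a x h_b x h_c that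
    boundary consists of pairs of cells exchanged by the antipodes, at which s_j
    differs by its character.  By induction the sum of W over h_a x h_b x h_c is
    the coefficient of x0^a x1^b x2^c ([sum_flags]).  If it is odd, some cell
    carries a flag along which every function changes sign, and a cluster
    point of such cells, as the mesh tends to 0, is a common zero. *)

(** * Cochains counted along flags of cells *)

Lemma F2_addrr (x : 'F_2) : x + x = 0.
Proof. by apply: addrr_pchar2; apply/pchar_Fp. Qed.

Lemma F2_natr_odd k : (k%:R != 0 :> 'F_2) = odd k.
Proof.
by rewrite -(dvdn_pcharf (pchar_Fp (isT : prime 2))) dvdn2 negbK.
Qed.

Lemma F2_addb (b1 b2 : bool) : ((b1 (+) b2)%:R : 'F_2) = b1%:R + b2%:R.
Proof. by case: b1; case: b2; rewrite /= ?addr0 ?add0r ?F2_addrr. Qed.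

Section Flags.
Variables (K J : eqType) (bd : K -> seq K) (s : J -> K -> 'F_2).

(** In dimension 1 this says that an edge has two end points. Cubes have an even
    number of faces in every positive dimension and a vertex has none, so that
    no dimension need be recorded. *)
Definition bd_even := forall x, \sum_(y <- bd x) (1 : 'F_2) = 0.
Definition bd_squared0 := forall (phi : K -> 'F_2) x,
  \sum_(y <- bd x) \sum_(z <- bd y) phi z = 0.

(** The weight of x is the cup product of the coboundaries of the functions s j,
    for j in l, evaluated through the flags of faces that start at x. *)
Fixpoint flags (l : seq J) (x : K) : 'F_2 :=
  if l is j :: l' then \sum_(y <- bd x) (s j x + s j y) * flags l' y else 1.

Hypotheses (bdE : bd_even) (bdbd : bd_squared0).

(** A cup product of cocycles is a cocycle. In the expansion of the weights of
    the faces of x, one half of the terms sums to zero by induction and the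
    other half because the boundary of a boundary is zero. *)
Lemma flags_cocycle l x : \sum_(y <- bd x) flags l y = 0.
Proof.
elim: l x => [|j l IH] x /=; first exact: bdE.
under eq_bigr => y _ do under eq_bigr => z _ do rewrite mulrDl.
under eq_bigr => y _ do rewrite big_split /= -mulr_sumr IH mulr0 add0r.
exact: bdbd.
Qed.

(** The coboundary of s j, cup a cocycle, is the coboundary of s j times that
    cocycle. This is Stokes' formula for the weight: it moves the sum from x to
    the boundary of x. *)
Lemma flags_cons j l x :
  flags (j :: l) x = \sum_(y <- bd x) s j y * flags l y.
Proof.
rewrite /=; under eq_bigr => y _ do rewrite mulrDl.
by rewrite big_split /= -mulr_sumr flags_cocycle mulr0 add0r.
Qed.

(** Translating by T changes s j by a constant, and the weights only involve
    differences of values of s j. The predicate P singles out the cells on which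
    T acts without fixed point, where such an s can exist. *)
Lemma flags_equivariant (P : pred K) (T : K -> K) (chi : J -> 'F_2) :
    (forall x y, P x -> y \in bd x -> P y) ->
    (forall (phi : K -> 'F_2) x,
       \sum_(y <- bd (T x)) phi y = \sum_(y <- bd x) phi (T y)) ->
    (forall j x, P x -> s j (T x) = s j x + chi j) ->
  forall l x, P x -> flags l (T x) = flags l x.
Proof.
move=> Pbd Tbd Ts; elim=> [//|j l IH] x Px.
rewrite /= Tbd [LHS]big_seq [RHS]big_seq; apply: eq_bigr => y yx.
have Py := Pbd _ _ Px yx; rewrite IH // !Ts //.
by rewrite addrACA F2_addrr addr0.
Qed.

(** The cells obtained from x by passing to a face at most d times: they will be
    close to x when the cells are small. *)
Fixpoint reachable (d : nat) (x y : K) : bool :=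
  (y == x) || (if d is d'.+1 then has (fun z => reachable d' z y) (bd x) else false).

(** A nonzero weight comes from at least one flag along which each of the
    functions changes its value. *)
Lemma flags_witness l x j : j \in l -> flags l x != 0 ->
  exists y z, [/\ reachable (size l) x y, reachable (size l) x z & s j y != s j z].
Proof.
elim: l x => [//|i l IH] x jl nz.
have /hasP[y yx ynz] : has (fun y => (s i x + s i y) * flags l y != 0) (bd x).
  apply: contraNT nz => /hasPn h; rewrite /= big_seq big1 // => y /h.
  by rewrite negbK => /eqP.
have [sxy fy] : s i x != s i y /\ flags l y != 0.
  split; apply: contraNneq ynz => ->; first by rewrite F2_addrr mul0r.
  by rewrite mulr0.
move: jl; rewrite inE => /predU1P[->|jl].
  exists x, y; split=> //=; first by rewrite eqxx.
  by apply/orP; right; apply/hasP; exists y => //; case: (size l) => /= [|k]; rewrite eqxx.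
have [z [w [Wz Ww szw]]] := IH y jl fy.
by exists z, w; split=> //=; apply/orP; right; apply/hasP; exists y.
Qed.

End Flags.

Section ProductComplex.
Variables (K L : eqType) (bdK : K -> seq K) (bdL : L -> seq L).

(** Mod 2, the Leibniz rule has no sign. *)
Definition bd_prod (x : K * L) : seq (K * L) :=
  [seq (y, x.2) | y <- bdK x.1] ++ [seq (x.1, z) | z <- bdL x.2].

Lemma sum_bd_prod (phi : K * L -> 'F_2) x :
  \sum_(p <- bd_prod x) phi p =
  \sum_(y <- bdK x.1) phi (y, x.2) + \sum_(z <- bdL x.2) phi (x.1, z).
Proof. by rewrite big_cat !big_map. Qed.

Lemma bd_prod_even : bd_even bdK -> bd_even bdL -> bd_even bd_prod.
Proof. by move=> eK eL x; rewrite sum_bd_prod eK eL addr0. Qed.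

(** The mixed terms, a face in one factor and a face in the other, occur in both
    orders and cancel. *)
Lemma bd_prod_bd0 : bd_squared0 bdK -> bd_squared0 bdL -> bd_squared0 bd_prod.
Proof.
move=> dK dL phi x; rewrite sum_bd_prod.
under eq_bigr => y _ do rewrite sum_bd_prod.
under [X in _ + X]eq_bigr => z _ do rewrite sum_bd_prod.
rewrite !big_split /= (dK (fun y => phi (y, x.2))) (dL (fun z => phi (x.1, z))).
by rewrite add0r addr0 exchange_big /= F2_addrr.
Qed.

End ProductComplex.

(** * Cells of the cubical grid *)

(** The pair (p, false) stands for the vertex p of the real line and (p, true)
    for the edge from p to p + 1. A cell of the cubical grid is a list of these.
    *)
Definition bd1 (e : int * bool) : seq (int * bool) :=
  if e.2 then [:: (e.1, false); (e.1 + 1, false)] else [::].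

(** The antipode sends the edge from p to p + 1 to the edge from - p - 1 to - p.
    *)
Definition opp1 (e : int * bool) : int * bool :=
  (if e.2 then - e.1 - 1 else - e.1, e.2).

Fixpoint bdl (x : seq (int * bool)) : seq (seq (int * bool)) :=
  if x is e :: x' then
    [seq e' :: x' | e' <- bd1 e] ++ [seq e :: y | y <- bdl x']
  else [::].

Definition oppl := map opp1.

Lemma opp1K : involutive opp1.
Proof. by case=> p []; rewrite /opp1 /= ?opprK // opprB opprK [_ + p]addrC addrK. Qed.

Lemma opp1_0 : opp1 (0, false) = (0, false). Proof. by rewrite /opp1 /= oppr0. Qed.

Lemma sum_bdl_cons (phi : seq (int * bool) -> 'F_2) e x :
  \sum_(y <- bdl (e :: x)) phi y =
  \sum_(e' <- bd1 e) phi (e' :: x) + \sum_(y <- bdl x) phi (e :: y).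
Proof. by rewrite /= big_cat !big_map. Qed.

Lemma bd1_even : bd_even bd1.
Proof. by case=> p []; rewrite ?big_nil // !big_cons big_nil addr0 F2_addrr. Qed.

Lemma bdl_even : bd_even bdl.
Proof.
elim=> [|e x IH]; first by rewrite big_nil.
by rewrite sum_bdl_cons IH bd1_even addr0.
Qed.

(** A vertex or edge has no iterated face in the same coordinate; faces in two
    different coordinates commute. *)
Lemma bdl_bd0 : bd_squared0 bdl.
Proof.
move=> phi x; elim: x phi => [|e x IH] phi; first by rewrite big_nil.
rewrite sum_bdl_cons.
under eq_bigr => y _ do rewrite sum_bdl_cons.
under [X in _ + X]eq_bigr => z _ do rewrite sum_bdl_cons.
rewrite !big_split /= IH addr0 [X in X + _ + _]big1_seq ?add0r; last first.
  by case: e => p [] /= e'; rewrite // !inE => /orP[] /eqP->; rewrite big_nil.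
by rewrite exchange_big /= F2_addrr.
Qed.

Lemma sum_bd1_opp (phi : int * bool -> 'F_2) e :
  \sum_(y <- bd1 (opp1 e)) phi y = \sum_(y <- bd1 e) phi (opp1 y).
Proof.
case: e => p []; rewrite ?big_nil // /bd1 /= !big_cons !big_nil /opp1 /=.
by rewrite subrK opprD !addr0 addrC.
Qed.

Lemma sum_bdl_opp (phi : seq (int * bool) -> 'F_2) x :
  \sum_(y <- bdl (oppl x)) phi y = \sum_(y <- bdl x) phi (oppl y).
Proof.
elim: x phi => [|e x IH] phi; first by rewrite !big_nil.
by rewrite [oppl _]/= !sum_bdl_cons sum_bd1_opp IH.
Qed.

(** * Hemispheres as chains *)

Section Hemispheres.
Variable N : nat.

Definition pole : int * bool := (N%:Z, false).
Definition up_edges : seq (int * bool) := [seq (i%:Z, true) | i <- iota 0 N].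
Definition all_edges := up_edges ++ map opp1 up_edges.

(** The cells of top dimension in the cube of side 2N in R^d. *)
Fixpoint ball_cells (d : nat) : seq (seq (int * bool)) :=
  if d is d'.+1 then [seq e :: x | e <- all_edges, x <- ball_cells d'] else [:: [::]].

(** The cells of dimension d - 1 of the boundary of the cube of side 2N in R^d.
    *)
Fixpoint sphere_cells (d : nat) : seq (seq (int * bool)) :=
  if d is d'.+1 then
    [seq e :: x | e <- [:: pole; opp1 pole], x <- ball_cells d'] ++
    [seq e :: x | e <- all_edges, x <- sphere_cells d']
  else [::].

(** One face of the cube of side 2N in R^(d+1), and the part above the equator
    of the sides adjacent to it. *)
Definition hemisphere (d : nat) :=
  map (cons pole) (ball_cells d) ++
  [seq e :: x | e <- up_edges, x <- sphere_cells d].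

(** The sum telescopes. *)
Lemma sum_up_edges (phi : int * bool -> 'F_2) :
  \sum_(e <- up_edges) \sum_(e' <- bd1 e) phi e' = phi (0, false) + phi pole.
Proof.
rewrite /up_edges big_map; transitivity (\sum_(i <- iota 0 N) (phi (i%:Z, false) + phi (i.+1%:Z, false))).
  have S i : i%:Z + 1 = i.+1%:Z by rewrite -addn1 PoszD.
  by apply: eq_bigr => i _; rewrite !big_cons big_nil addr0 /= S.
rewrite /pole; elim: N => [|n IH]; first by rewrite big_nil F2_addrr.
have -> : iota 0 n.+1 = iota 0 n ++ [:: n] by rewrite -addn1 iotaD.
rewrite big_cat /= IH big_seq1.
by rewrite addrA -[X in X + _]addrA F2_addrr addr0.
Qed.

Lemma sum_all_edges_opp (phi : int * bool -> 'F_2) :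
  \sum_(e <- all_edges) phi (opp1 e) = \sum_(e <- all_edges) phi e.
Proof.
rewrite /all_edges !big_cat /= !big_map addrC; congr (_ + _).
by apply: eq_bigr => i _; rewrite opp1K.
Qed.

Lemma sum_all_edges_bd (phi : int * bool -> 'F_2) :
  \sum_(e <- all_edges) \sum_(e' <- bd1 e) phi e' = phi pole + phi (opp1 pole).
Proof.
rewrite /all_edges big_cat /= big_map sum_up_edges.
under eq_bigr => e _ do rewrite sum_bd1_opp.
rewrite (sum_up_edges (phi \o opp1)) /= opp1_0.
by rewrite addrACA F2_addrr add0r.
Qed.

Lemma sum_allcons (phi : seq (int * bool) -> 'F_2) es xs :
  \sum_(y <- [seq e :: x | e <- es, x <- xs]) phi y =
  \sum_(e <- es) \sum_(x <- xs) phi (e :: x).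
Proof. by rewrite big_allpairs_dep. Qed.

Lemma sum_allcons_bd (phi : seq (int * bool) -> 'F_2) es xs :
  \sum_(y <- [seq e :: x | e <- es, x <- xs]) \sum_(z <- bdl y) phi z =
  \sum_(x <- xs) \sum_(e <- es) \sum_(e' <- bd1 e) phi (e' :: x) +
  \sum_(e <- es) \sum_(x <- xs) \sum_(z <- bdl x) phi (e :: z).
Proof.
rewrite sum_allcons exchange_big [X in _ = _ + X]exchange_big -big_split /=.
apply: eq_bigr => x _; rewrite -big_split /=.
by apply: eq_bigr => e _; rewrite sum_bdl_cons.
Qed.

Lemma sum_sphere_cells d (phi : seq (int * bool) -> 'F_2) :
  \sum_(x <- sphere_cells d.+1) phi x =
  \sum_(x <- ball_cells d) (phi (pole :: x) + phi (opp1 pole :: x)) +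
  \sum_(e <- all_edges) \sum_(x <- sphere_cells d) phi (e :: x).
Proof.
etransitivity; first exact: big_cat.
by rewrite !sum_allcons !big_cons big_nil addr0 -big_split.
Qed.

Lemma ball_cells_bd d (phi : seq (int * bool) -> 'F_2) :
  \sum_(x <- ball_cells d) \sum_(y <- bdl x) phi y =
  \sum_(y <- sphere_cells d) phi y.
Proof.
elim: d phi => [|d IH] phi; first by rewrite big_seq1 !big_nil.
rewrite sum_allcons_bd sum_sphere_cells.
congr (_ + _); apply: eq_bigr => e _; first exact: (sum_all_edges_bd (fun e' => phi (e' :: e))).
exact: (IH (fun z => phi (e :: z))).
Qed.

(** The sphere is the boundary of the ball. *)
Lemma sphere_cells_bd d (phi : seq (int * bool) -> 'F_2) :
  \sum_(x <- sphere_cells d) \sum_(y <- bdl x) phi y = 0.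
Proof.
by rewrite -ball_cells_bd big1 // => x _; rewrite bdl_bd0.
Qed.

Lemma ball_cells_opp d (phi : seq (int * bool) -> 'F_2) :
  \sum_(x <- ball_cells d) phi (oppl x) = \sum_(x <- ball_cells d) phi x.
Proof.
elim: d phi => [|d IH] phi; first by rewrite !big_seq1.
rewrite !sum_allcons -[RHS]sum_all_edges_opp; apply: eq_bigr => e _.
exact: (IH (fun x => phi (opp1 e :: x))).
Qed.

Lemma sphere_cells_opp d (phi : seq (int * bool) -> 'F_2) :
  \sum_(x <- sphere_cells d) phi (oppl x) = \sum_(x <- sphere_cells d) phi x.
Proof.
rewrite -!ball_cells_bd -[RHS]ball_cells_opp.
by apply: eq_bigr => x _; rewrite sum_bdl_opp.
Qed.

Lemma sphere_cellsS d (phi : seq (int * bool) -> 'F_2) :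
  \sum_(x <- sphere_cells d.+1) phi x =
  \sum_(x <- hemisphere d) (phi x + phi (oppl x)).
Proof.
rewrite sum_sphere_cells !big_split /= !big_cat /= !big_map !sum_allcons.
rewrite [in RHS](ball_cells_opp d (fun x => phi (opp1 pole :: x))) addrACA.
rewrite !big_map; congr (_ + _ + (_ + _)); apply: eq_bigr => i _.
by rewrite [RHS](sphere_cells_opp d (fun x => phi (opp1 (i%:Z, true) :: x))).
Qed.

(** The lid of the hemisphere is bounded by the upper rim of the sides, which
    cancels; the equator remains. *)
Lemma hemisphere_bd d (phi : seq (int * bool) -> 'F_2) :
  \sum_(x <- hemisphere d) \sum_(y <- bdl x) phi y =
  \sum_(x <- sphere_cells d) phi ((0, false) :: x).
Proof.
rewrite big_cat /= big_map sum_allcons_bd.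
under eq_bigr => x _ do rewrite sum_bdl_cons big_nil add0r.
rewrite (ball_cells_bd d (fun x => phi (pole :: x))).
under [X in _ + (X + _)]eq_bigr => x _ do rewrite (sum_up_edges (fun e => phi (e :: x))).
rewrite big_split /= [X in _ + (_ + X)]big1 ?addr0 => [|e _].
  by rewrite addrCA F2_addrr addr0.
exact: (sphere_cells_bd d (fun z => phi (e :: z))).
Qed.

Variable n : nat.

(** The leading zeros place the hemispheres of all dimensions in the same sphere
    of R^(n+1), in such a way that the equator of one is the union of the next
    lower one with its antipode. *)
Definition subhemisphere (d : nat) : seq (seq (int * bool)) :=
  map (cat (nseq (n - d) (0, false))) (hemisphere d).

Lemma sum_bdl_nseq k (phi : seq (int * bool) -> 'F_2) x :
  \sum_(y <- bdl (nseq k (0, false) ++ x)) phi y =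
  \sum_(y <- bdl x) phi (nseq k (0, false) ++ y).
Proof.
elim: k phi => [|k IH] phi //=.
by rewrite big_map IH.
Qed.

Lemma oppl_nseq k x :
  oppl (nseq k (0, false) ++ x) = nseq k (0, false) ++ oppl x.
Proof. by rewrite /oppl map_cat map_nseq opp1_0. Qed.

Lemma subhemisphere_bd d (phi : seq (int * bool) -> 'F_2) : (d < n)%N ->
  \sum_(x <- subhemisphere d.+1) \sum_(y <- bdl x) phi y =
  \sum_(x <- subhemisphere d) (phi x + phi (oppl x)).
Proof.
move=> dn; rewrite !big_map.
under eq_bigr => x _ do rewrite sum_bdl_nseq.
rewrite (hemisphere_bd _ (fun x => phi (nseq (n - d.+1) (0, false) ++ x))).
rewrite (sphere_cellsS _ (fun x => phi (nseq (n - d.+1) (0, false) ++ (0, false) :: x))).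
apply: eq_bigr => x _; rewrite oppl_nseq -!cat_rcons.
have E k : rcons (nseq k (0 : int, false)) (0, false) = nseq k.+1 (0, false).
  by elim: k => //= k ->.
by rewrite E subnSK.
Qed.

Lemma subhemisphere0_bd (phi : seq (int * bool) -> 'F_2) :
  \sum_(x <- subhemisphere 0) \sum_(y <- bdl x) phi y = 0.
Proof.
rewrite big_map; under eq_bigr => x _ do rewrite sum_bdl_nseq.
by rewrite (hemisphere_bd 0 (fun x => phi (nseq (n - 0) (0, false) ++ x))) big_nil.
Qed.

Definition in_range (e : int * bool) : bool :=
  (- N%:Z <= e.1) && (if e.2 then e.1 < N%:Z else e.1 <= N%:Z).

Definition is_pole (e : int * bool) : bool := (e == pole) || (e == opp1 pole).

(** For N > 0 a cell with a coordinate N or - N stays away from the origin,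
    which is the only fixed point of the antipode; as such a coordinate is a
    vertex, all faces of the cell share it. *)
Definition on_sphere (x : seq (int * bool)) : bool :=
  [&& size x == n.+1, all in_range x & has is_pole x].

Lemma on_sphere_bd x y : on_sphere x -> y \in bdl x -> on_sphere y.
Proof.
rewrite /on_sphere; case/and3P => /eqP <-; elim: x y => [//|e x IH] y /=.
move=> /andP[re ax] hx; rewrite mem_cat => /orP[] /mapP[z zx ->] /=.
  case: e re hx zx => p [] //= /andP[/= p1 p2] hx.
  have {}hx : has is_pole x by move: hx; rewrite /is_pole !eqE /= !andbF.
  by rewrite eqxx ax hx orbT !inE => /orP[] /eqP->; rewrite /in_range /=; lia.
move: hx; have [hz _|hz] := boolP (has is_pole x).
  by have /and3P[/eqP-> -> ->] := IH z ax hz zx; rewrite re eqxx orbT.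
rewrite orbF => ->; rewrite re eqSS /= andbT {hz}.
elim: x z ax zx {IH} => [//|f x IH] z /= /andP[rf ax].
rewrite mem_cat => /orP[] /mapP[w wx ->] /=.
  case: f rf wx => p [] //= /andP[/= p1 p2].
  by rewrite eqxx ax !inE => /orP[] /eqP->; rewrite /in_range /=; lia.
by have /andP[/eqP-> ->] := IH w ax wx; rewrite rf eqxx.
Qed.

Lemma subhemisphere_on_sphere d x : (d <= n)%N ->
  x \in subhemisphere d -> on_sphere x.
Proof.
move=> dn /mapP[y yh ->].
have r_up e : e \in up_edges -> in_range e.
  by move=> /mapP[i]; rewrite mem_iota => /andP[_ iN] ->; rewrite /in_range /=; lia.
have r_edge e : e \in all_edges -> in_range e.
  rewrite mem_cat => /orP[/r_up //|/mapP[f]].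
  by move=> /mapP[i]; rewrite mem_iota => /andP[_ iN] -> ->; rewrite /in_range /=; lia.
have r_pole : in_range pole && in_range (opp1 pole) by rewrite /in_range /=; lia.
have ballP k z : z \in ball_cells k -> size z = k /\ all in_range z.
  elim: k z => [|k IH] z; first by rewrite inE => /eqP->.
  by case/allpairsP => -[e w] [/= /r_edge re /IH[sw aw] ->] /=; rewrite sw re aw.
have sphereP k z : z \in sphere_cells k -> [/\ size z = k, all in_range z & has is_pole z].
  elim: k z => [|k IH] z //; rewrite mem_cat => /orP[] /allpairsP [[e w] [/= ee]].
    move=> /ballP[sw aw] ->; rewrite /= sw aw; move: ee r_pole; rewrite !inE /is_pole => ee /andP[r1 r2].
    by case/orP: ee => /eqP->; rewrite ?r1 ?r2 eqxx ?orbT.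
  by move=> /IH[sw aw hw] ->; rewrite /= sw aw hw (r_edge _ ee) orbT.
rewrite /on_sphere size_cat size_nseq all_cat has_cat.
have -> : all in_range (nseq (n - d) (0, false)).
  by rewrite all_nseq /in_range /=; lia.
suff [-> -> ->] : [/\ size y = d.+1, all in_range y & has is_pole y].
  by rewrite orbT addnS subnK // eqxx.
case/andP: r_pole => r1 _.
move: yh; rewrite mem_cat => /orP[/mapP[z /ballP[sz az] ->]|/allpairsP[[e z] [/= ee]]]; last first.
  by move=> /sphereP[sz az hz] ->; rewrite /= sz az hz (r_up _ ee) orbT.
by rewrite /= sz az r1 /is_pole eqxx.
Qed.

End Hemispheres.

(** * The discrete Borsuk-Ulam theorem for three spheres *)

Section TripleProduct.
Variables (N n : nat).

Local Notation L := (seq (int * bool)).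
Definition bd3 := bd_prod (bd_prod bdl bdl) bdl.

Definition flip0 (p : L * L * L) : L * L * L := (oppl p.1.1, p.1.2, p.2).
Definition flip1 (p : L * L * L) : L * L * L := (p.1.1, oppl p.1.2, p.2).
Definition flip2 (p : L * L * L) : L * L * L := (p.1.1, p.1.2, oppl p.2).

Definition hemisphere3 (a b c : nat) : seq (L * L * L) :=
  [seq (p, z) | p <- [seq (x, y) | x <- subhemisphere N n a, y <- subhemisphere N n b],
                z <- subhemisphere N n c].

Definition on_spheres (p : L * L * L) : bool :=
  [&& on_sphere N n p.1.1, on_sphere N n p.1.2 & on_sphere N n p.2].

Lemma bd3_even : bd_even bd3.
Proof. by do !apply: bd_prod_even; exact: bdl_even. Qed.

Lemma bd3_bd0 : bd_squared0 bd3.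
Proof. by do !apply: bd_prod_bd0; exact: bdl_bd0. Qed.

Lemma sum_bd3 (phi : L * L * L -> 'F_2) p :
  \sum_(q <- bd3 p) phi q =
    \sum_(x <- bdl p.1.1) phi (x, p.1.2, p.2) +
    \sum_(y <- bdl p.1.2) phi (p.1.1, y, p.2) +
    \sum_(z <- bdl p.2) phi (p.1.1, p.1.2, z).
Proof.
case: p => [[x y] z]; rewrite sum_bd_prod; congr (_ + _).
exact: (sum_bd_prod _ _ (fun q => phi (q, z))).
Qed.

Lemma sum_bd3_flip0 (phi : L * L * L -> 'F_2) p :
  \sum_(q <- bd3 (flip0 p)) phi q = \sum_(q <- bd3 p) phi (flip0 q).
Proof. by rewrite !sum_bd3 /= (sum_bdl_opp (fun x => phi (x, p.1.2, p.2))). Qed.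

Lemma sum_bd3_flip1 (phi : L * L * L -> 'F_2) p :
  \sum_(q <- bd3 (flip1 p)) phi q = \sum_(q <- bd3 p) phi (flip1 q).
Proof. by rewrite !sum_bd3 /= (sum_bdl_opp (fun x => phi (p.1.1, x, p.2))). Qed.

Lemma sum_bd3_flip2 (phi : L * L * L -> 'F_2) p :
  \sum_(q <- bd3 (flip2 p)) phi q = \sum_(q <- bd3 p) phi (flip2 q).
Proof. by rewrite !sum_bd3 /= (sum_bdl_opp (fun x => phi (p.1.1, p.1.2, x))). Qed.

Lemma on_spheres_bd p q : on_spheres p -> q \in bd3 p -> on_spheres q.
Proof.
case/and3P=> s0 s1 s2; rewrite mem_cat => /orP[] /mapP[r]; last first.
  by move=> rp ->; rewrite /on_spheres /= s0 s1 (on_sphere_bd s2 rp).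
rewrite mem_cat => /orP[] /mapP[x xp -> ->]; rewrite /on_spheres /= s2.
  by rewrite s1 (on_sphere_bd s0 xp).
by rewrite s0 (on_sphere_bd s1 xp).
Qed.

Lemma hemisphere3_on_spheres a b c p : (a <= n)%N -> (b <= n)%N -> (c <= n)%N ->
  p \in hemisphere3 a b c -> on_spheres p.
Proof.
move=> an bn cn /allpairsP[[q z] /= [/allpairsP[[x y] /= [xa yb ->]] zc ->]].
by apply/and3P; split; [move: xa|move: yb|move: zc]; exact: subhemisphere_on_sphere.
Qed.

Lemma sum_hemisphere3 (phi : L * L * L -> 'F_2) a b c :
  \sum_(p <- hemisphere3 a b c) phi p =
  \sum_(x <- subhemisphere N n a) \sum_(y <- subhemisphere N n b)
    \sum_(z <- subhemisphere N n c) phi (x, y, z).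
Proof. by rewrite big_allpairs_dep big_allpairs_dep. Qed.

(** The boundary of a product of three hemispheres consists of antipodal pairs
    in each factor. *)
Lemma hemisphere3_bd (phi : L * L * L -> 'F_2) a b c :
  (a <= n)%N -> (b <= n)%N -> (c <= n)%N ->
  \sum_(p <- hemisphere3 a b c) \sum_(q <- bd3 p) phi q =
    (if a is a'.+1 then \sum_(p <- hemisphere3 a' b c) (phi p + phi (flip0 p)) else 0) +
    (if b is b'.+1 then \sum_(p <- hemisphere3 a b' c) (phi p + phi (flip1 p)) else 0) +
    (if c is c'.+1 then \sum_(p <- hemisphere3 a b c') (phi p + phi (flip2 p)) else 0).
Proof.
have bdE d (psi : L -> 'F_2) : (d <= n)%N ->
    \sum_(x <- subhemisphere N n d) \sum_(y <- bdl x) psi y =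
    if d is d'.+1 then \sum_(x <- subhemisphere N n d') (psi x + psi (oppl x)) else 0.
  by case: d => [_|d dn]; rewrite ?subhemisphere0_bd ?subhemisphere_bd.
move=> an bn cn; rewrite sum_hemisphere3.
under eq_bigr => x _ do under eq_bigr => y _ do under eq_bigr => z _ do rewrite sum_bd3 /=.
under eq_bigr => x _ do under eq_bigr => y _ do rewrite !big_split /=.
under eq_bigr => x _ do rewrite !big_split /=.
rewrite !big_split /=; congr (_ + _ + _).
- rewrite exchange_big /=.
  under eq_bigr => y _ do rewrite exchange_big /=.
  under eq_bigr => y _ do under eq_bigr => z _ do rewrite (bdE _ (fun x => phi (x, y, z))) //.
  case: a {an} => [|a]; first by rewrite big1 // => y _; rewrite big1.
  rewrite sum_hemisphere3 [RHS]exchange_big /=; apply: eq_bigr => y _.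
  by rewrite [RHS]exchange_big.
- under eq_bigr => x _ do rewrite exchange_big /=.
  under eq_bigr => x _ do under eq_bigr => z _ do rewrite (bdE _ (fun y => phi (x, y, z))) //.
  case: b {bn} => [|b]; first by rewrite big1 // => y _; rewrite big1.
  rewrite sum_hemisphere3; apply: eq_bigr => y _.
  by rewrite [RHS]exchange_big.
- under eq_bigr => x _ do under eq_bigr => y _ do rewrite (bdE _ (fun z => phi (x, y, z))) //.
  case: c {cn} => [|c]; first by rewrite big1 // => y _; rewrite big1.
  by rewrite sum_hemisphere3.
Qed.

Variables (J : eqType) (chi0 chi1 chi2 : J -> bool).

(** The coefficient of x0^a x1^b x2^c in the product of the linear forms chi0 j
    x0 + chi1 j x1 + chi2 j x2 for j in l, by expanding the first factor. *)
Fixpoint char_coef (l : seq J) (a b c : nat) : 'F_2 :=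
  if l is j :: l' then
    (if a is a'.+1 then (chi0 j)%:R * char_coef l' a' b c else 0) +
    (if b is b'.+1 then (chi1 j)%:R * char_coef l' a b' c else 0) +
    (if c is c'.+1 then (chi2 j)%:R * char_coef l' a b c' else 0)
  else [&& a == 0, b == 0 & c == 0]%N%:R.

Variable s : J -> L * L * L -> 'F_2.
Hypothesis s_flip0 : forall j p, on_spheres p -> s j (flip0 p) = s j p + (chi0 j)%:R.
Hypothesis s_flip1 : forall j p, on_spheres p -> s j (flip1 p) = s j p + (chi1 j)%:R.
Hypothesis s_flip2 : forall j p, on_spheres p -> s j (flip2 p) = s j p + (chi2 j)%:R.

(** By Stokes' formula the sum over the product of hemispheres of the weight for
    j :: l is a sum over its boundary. There, two cells exchanged by an antipode
    have the same weight for l, and the values of s j at them differ by the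
    character of j; this leaves chi(j) times a sum over a smaller product of
    hemispheres, which is the recursion that defines the coefficient. *)
Lemma sum_flags l a b c : (a <= n)%N -> (b <= n)%N -> (c <= n)%N ->
  size l = (a + b + c)%N ->
  \sum_(p <- hemisphere3 a b c) flags bd3 s l p = char_coef l a b c.
Proof.
elim: l a b c => [|j l IH] a b c an bn cn.
  case: a b c {an bn cn} => [|//] [|//] [|//] _.
  by rewrite sum_hemisphere3 /subhemisphere /hemisphere /= (allpairs0r cons) !big_seq1.
rewrite [size _]/= => sz; under eq_bigr => p _ do rewrite (flags_cons _ bd3_even bd3_bd0).
rewrite hemisphere3_bd //=.
have count_step (T : L * L * L -> L * L * L) (chi : J -> bool) a' b' c' :
    (forall (phi : L * L * L -> 'F_2) p,
      \sum_(q <- bd3 (T p)) phi q = \sum_(q <- bd3 p) phi (T q)) ->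
    (forall j p, on_spheres p -> s j (T p) = s j p + (chi j)%:R) ->
    (a' <= n)%N -> (b' <= n)%N -> (c' <= n)%N -> size l = (a' + b' + c')%N ->
    \sum_(p <- hemisphere3 a' b' c')
      (s j p * flags bd3 s l p + s j (T p) * flags bd3 s l (T p)) =
    (chi j)%:R * char_coef l a' b' c'.
  move=> bdT sT a'n b'n c'n szl; rewrite -IH // mulr_sumr big_seq [RHS]big_seq.
  apply: eq_bigr => p /hemisphere3_on_spheres Pp; have {}Pp := Pp a'n b'n c'n.
  rewrite sT // (flags_equivariant on_spheres_bd bdT sT) // -mulrDl.
  by rewrite addrA F2_addrr add0r.
congr (_ + _ + _).
- case: a an sz => // a an sz; apply: count_step (sum_bd3_flip0) s_flip0 _ bn cn _; lia.
- case: b bn sz => // b bn sz; apply: count_step (sum_bd3_flip1) s_flip1 an _ cn _; lia.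
- case: c cn sz => // c cn sz; apply: count_step (sum_bd3_flip2) s_flip2 an bn _ _; lia.
Qed.

(** A nonzero total weight forces a cell of nonzero weight, around which every
    function changes sign. *)
Lemma discrete_borsuk_ulam l a b c : (a <= n)%N -> (b <= n)%N -> (c <= n)%N ->
  size l = (a + b + c)%N -> char_coef l a b c != 0 ->
  exists2 p, on_spheres p & forall j, j \in l ->
    exists q r, [/\ reachable bd3 (size l) p q, reachable bd3 (size l) p r & s j q != s j r].
Proof.
move=> an bn cn sz; rewrite -sum_flags // => nz.
have /hasP[p pc fp] : has (fun p => flags bd3 s l p != 0) (hemisphere3 a b c).
  apply: contraNT nz => /hasPn h; rewrite big_seq big1 // => p /h.
  by rewrite negbK => /eqP.
by exists p => [|j jl]; [exact: hemisphere3_on_spheres pc | exact: flags_witness].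
Qed.

End TripleProduct.

(** * Binomial coefficients mod 2 and the function kappa *)

Section BinomialParity.
Local Open Scope nat_scope.

(** Lucas' theorem mod 2 for the last binary digit: the binomial of two digits
    is 0 only for 0 over 1. *)
Lemma odd_bin_half n k :
  odd 'C(n, k) = (odd n || ~~ odd k) && odd 'C(n./2, k./2).
Proof.
have even_case m : forall i, odd 'C(m.*2, i) = ~~ odd i && odd 'C(m, i./2).
  elim: m => [|m IH] i; first by case: i => [|[|i]] //=; rewrite andbF.
  case: i => [|[|i]]; first by rewrite !bin0.
    by rewrite bin1 odd_double.
  rewrite doubleS !binS !oddD !IH /= negbK.
  by case: (odd i); case: (odd 'C(_, _)); case: (odd 'C(_, _)).
case: (boolP (odd n)) => on; last first.
  by rewrite -[in LHS](even_halfK on) even_case.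
have -> : 'C(n, k) = 'C(n./2.*2.+1, k) by rewrite -[in LHS](odd_double_half n) on.
case: k => [|k]; first by rewrite !bin0.
rewrite binS oddD !even_case /= uphalf_half negbK.
by case: (odd k); rewrite /= ?addn0 ?addbF ?add1n.
Qed.

Lemma odd_bin_exp2M p A B : odd 'C(2 ^ p * A, 2 ^ p * B) = odd 'C(A, B).
Proof.
elim: p => [|p IH]; first by rewrite !mul1n.
by rewrite odd_bin_half expnS -!mulnA !oddM /= !mul2n !doubleK.
Qed.

(** The last w binary digits of the upper entry are all 1, so they put no
    condition on those of the lower entry. *)
Lemma odd_bin_exp2_pred w A B r : r < 2 ^ w ->
  odd 'C(2 ^ w * A + (2 ^ w - 1), 2 ^ w * B + r) = odd 'C(A, B).
Proof.
elim: w r => [|w IH] r rw; first by have -> : r = 0 by [lia]; rewrite !mul1n !addn0.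
have w0 : 0 < 2 ^ w by rewrite expn_gt0.
rewrite odd_bin_half; have -> : odd (2 ^ w.+1 * A + (2 ^ w.+1 - 1)).
  rewrite expnS -mulnA oddD oddM /= oddB; last lia.
  by rewrite oddM.
rewrite /= -(IH r./2); last by rewrite expnS in rw; lia.
by congr (odd 'C(_, _)); rewrite expnS; lia.
Qed.

Definition sparse n := forall i, ~~ (bit n i && bit n i.+1).

Lemma bit_shift n k i : bit (n %/ 2 ^ k) i = bit n (k + i).
Proof. by rewrite /bit expnD divnMA. Qed.

Lemma bit_0 n : bit n 0 = odd n. Proof. by rewrite /bit divn1. Qed.

Lemma bit_lt n i : bit n i -> i < n.
Proof.
move=> h; apply: leq_trans (ltn_expl i (isT : 1 < 2)) _.
by rewrite leqNgt; apply: contraL h => ni; rewrite /bit divn_small.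
Qed.

Lemma sparse_shift n k : sparse n -> sparse (n %/ 2 ^ k).
Proof. by move=> h i; rewrite !bit_shift addnS. Qed.

Lemma sparseP n : reflect (sparse n) (~~ consecutive_ones n).
Proof.
rewrite /consecutive_ones; apply: (iffP idP) => [/existsPn h i|h].
  case: (boolP (bit n i)) => //= bi.
  by have := h (Ordinal (bit_lt bi)); rewrite /= bi.
by apply/existsPn => i; exact: h.
Qed.

(** For sparse i the binary digits of i and 2 i are disjoint, so that 3 i = i +
    2 i is computed without carry. The induction removes one digit if i is even
    and two if i is odd. *)
Lemma sparse_odd_bin3 i : sparse i -> odd 'C(3 * i, 2 * i).
Proof.
have [k] := ubnP i; elim: k i => // k IH i ik si.
case: (posnP i) => [->//|i0].
have sh : sparse i./2 by rewrite -divn2; exact: (sparse_shift 1).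
rewrite odd_bin_half mul2n odd_double orbT doubleK /=.
have := odd_double_half i; case oi: (odd i) => ei; last first.
  have := IH i./2 ltac:(lia) sh.
  by congr (odd 'C(_, _)); lia.
have oh : odd i./2 = false.
  have := si 0; rewrite -bit_0 in oi; rewrite oi /=.
  by rewrite -[1]/(1 + 0) -bit_shift bit_0 divn2 => /negbTE.
have e2 := odd_double_half i./2; rewrite oh in e2.
rewrite odd_bin_half; have -> : odd (3 * i)./2 by lia.
rewrite /=; have /(IH i./2./2 ltac:(lia)) : sparse i./2./2.
  by rewrite -divn2; exact: (sparse_shift 1 sh).
by congr (odd 'C(_, _)); lia.
Qed.

(** The integer coefficient of x0^(2M+1-b-c) x1^b x2^c in (x0 + x1)^M (x0 +
    x2)^M (x1 + x2): one summand for each term of the last factor. *)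
Definition pair_coef M b c :=
  (if b is b'.+1 then 'C(M, b') * 'C(M, c) else 0) +
  (if c is c'.+1 then 'C(M, b) * 'C(M, c') else 0).

(** The two summands are the square of the binomial over n - 1 and the product
    of those over n and n - 2. As M is even, only even lower entries give odd
    binomials, so exactly one of the summands can be odd, according to the
    parity of n. *)
Lemma pair_coef_pred M n : 0 < n -> ~~ odd M ->
  odd 'C(M, n./2.*2) -> (~~ odd n -> odd 'C(M, n./2.*2 - 2)) ->
  odd (pair_coef M n n.-1).
Proof.
case: n => // n _ oM; rewrite /pair_coef /= uphalf_half.
have zero k : odd k -> odd 'C(M, k) = false.
  by move=> ok; rewrite odd_bin_half ok (negbTE oM).
have := odd_double_half n; case on: (odd n) => en h1 h2; last first.
  rewrite add0n in en h1; rewrite en in h1.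
  move: on en h1 h2; case: n => [|n] on en h1 h2; first by rewrite !bin0.
  have /zero z : odd n.+2 by rewrite oddS on.
  by rewrite oddD !oddM h1 z.
move: on en h1 h2; case: n => [|n] // on en h1 h2.
rewrite oddD !oddM zero // -en.
have {}h1 : odd 'C(M, n.+2) by move: h1; congr (odd 'C(_, _)); lia.
have {}h2 : odd 'C(M, n) by move: (h2 isT); congr (odd 'C(_, _)); lia.
by rewrite en h1 h2.
Qed.

(** The inequalities say that the three exponents b, c and 2M + 1 - b - c lie
    between 0 and n. *)
Definition admissible n M := exists b c,
  [/\ b <= n, c <= n, b + c <= M.*2.+1 <= b + c + n & odd (pair_coef M b c)].

(** Write n = 2^p (2 q + 1); then M = 2^p (3 q + 1). The exponents b = n and c =
    2^(p+1) q + 1 reduce the coefficient to the product of the binomials of 3 q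
    + 1 over 2 q + 1 and over 2 q, which are odd since q is even and sparse. *)
Lemma admissible_sparse_even n : 0 < n -> sparse n -> ~~ odd n ->
  admissible n (n + (n - 2 ^ logn 2 n) %/ 2).
Proof.
move=> n0 sn en; set p := logn 2 n.
have [m cm nE] := pfactor_coprime (isT : prime 2) n0; rewrite -/p in nE.
rewrite coprime2n in cm; have mE := odd_double_half m; rewrite cm in mE.
have p0 : 0 < p by case: p nE => // nE; rewrite nE muln1 cm in en.
set q := m./2 in mE *.
have sm : sparse m.
  by have := sparse_shift p sn; rewrite {1}nE mulnK // expn_gt0.
have sq : sparse q by rewrite /q -divn2; exact: (sparse_shift 1 sm).
have oq : odd q = false.
  have := sm 0; rewrite bit_0 cm /=.
  by rewrite -[1]/(1 + 0) -bit_shift bit_0 divn2 => /negbTE.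
have qE := odd_double_half q; rewrite oq in qE.
have h3 : odd 'C(3 * q./2, 2 * q./2).
  by apply: sparse_odd_bin3; rewrite -divn2; exact: (sparse_shift 1 sq).
have P0 : 0 < 2 ^ p by rewrite expn_gt0.
have Pe : 2 ^ p = 2 * 2 ^ p.-1 by rewrite -expnS prednK.
have -> : (n - 2 ^ p) %/ 2 = 2 ^ p * q.
  by rewrite nE -mE -{2}[2 ^ p]mul1n -mulnBl addKn -mul2n -mulnA mulKn // mulnC.
have ME : n + 2 ^ p * q = 2 ^ p * (3 * q + 1) by rewrite nE -mE; nia.
exists n, (2 ^ p * (2 * q)).+1; split=> //; rewrite ?ME.
- by rewrite nE -mE; nia.
- by rewrite nE -mE; nia.
set M := 2 ^ p * (3 * q + 1).
have eM : odd M = false by rewrite oddM Pe oddM.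
have hn : odd 'C(M, n).
  rewrite nE -mE mulnC odd_bin_exp2M odd_bin_half.
  have -> : odd (3 * q + 1) by lia.
  by move: h3; rewrite /=; congr (odd 'C(_, _)); lia.
have hc : odd 'C(M, 2 ^ p * (2 * q)).
  rewrite odd_bin_exp2M odd_bin_half.
  have -> : odd (3 * q + 1) by lia.
  by move: h3; rewrite /=; congr (odd 'C(_, _)); lia.
have hn1 : odd 'C(M, n.-1) = false.
  by rewrite odd_bin_half eM; have -> : odd n.-1 by lia.
(* The other summand contains a binomial of the even M over the odd n - 1. *)
rewrite /pair_coef -{1}(prednK n0) oddD !oddM hn1 hn hc.
by [].
Qed.

Lemma admissible_pred n M : 0 < n -> n <= M.+1 -> M.*2 <= 3 * n - 2 -> ~~ odd M ->
  odd 'C(M, n./2.*2) -> (~~ odd n -> odd 'C(M, n./2.*2 - 2)) ->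
  admissible n M.
Proof.
move=> n0 nM Mn eM h1 h2; exists n, n.-1; split=> //; try lia.
exact: pair_coef_pred.
Qed.

(** With n = 2 j + 1 one has M = 3 j, and the binomial of 3 j over 2 j = n - 1
    is odd. *)
Lemma admissible_sparse_odd n : sparse n -> odd n ->
  admissible n (n + (n - 1) %/ 2 - 1).
Proof.
move=> sn on; have nE := odd_double_half n; rewrite on in nE.
have sj : sparse n./2 by rewrite -divn2; exact: (sparse_shift 1).
have ej : odd n./2 = false.
  have := sn 0; rewrite bit_0 on /=.
  by rewrite -[1]/(1 + 0) -bit_shift bit_0 divn2 => /negbTE.
have -> : n + (n - 1) %/ 2 - 1 = 3 * n./2 by lia.
apply: admissible_pred; rewrite ?on //; try lia.
by rewrite -mul2n; exact: sparse_odd_bin3.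
Qed.

(** Here M = 2^t - 2, over which all binomials with an even lower entry at most
    M are odd; the lower bound on n makes room for exponents n and n - 1. *)
Lemma admissible_large n t : 0 < n -> n < 2 ^ t -> maxsparse t < n ->
  admissible n (n + (2 ^ t - n - 1) - 1).
Proof.
rewrite /maxsparse => n0 nt Ln.
have tn : 2 ^ t.+1 < 3 * n by rewrite mulnC -ltn_divLR.
case: t nt Ln tn => [|t] nt Ln tn; first lia.
rewrite 2!expnS in tn nt.
have -> : n + (2 ^ t.+1 - n - 1) - 1 = (2 ^ t - 1).*2 by rewrite expnS; lia.
have h k : k < 2 ^ t -> odd 'C((2 ^ t - 1).*2, k.*2).
  move=> kt; rewrite odd_bin_half !odd_double !doubleK /=.
  by have := @odd_bin_exp2_pred t 0 0 k kt; rewrite !muln0 bin0.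
apply: admissible_pred => //; try lia.
- by apply: h; lia.
- by move=> en; have := h n./2.-1 ltac:(lia); congr (odd 'C(_, _)); lia.
Qed.

(** With n = 2^u (8 a + 3) + b one has M = 2 (2^(u+1) 3 a + 2^(u+1) - 1). Above
    the last u + 2 digits the binomials compare 3 a with 2 a, where a is sparse;
    below, all digits of M but the last one are 1, so that every even lower
    entry is good. *)
Lemma admissible_block n u : block011 n u -> sparse (n %/ 2 ^ (u + 3)) ->
  admissible n (n + (2 ^ (u + 2) * (n %/ 2 ^ (u + 3)) + (2 ^ u - 1 - n %% 2 ^ u)) - 1).
Proof.
move=> blk; have bu : n %% 2 ^ u < 2 ^ u by rewrite ltn_pmod // expn_gt0.
set a := n %/ _; set b := n %% _ in bu * => sa.
have nE : n = 2 ^ u * (8 * a + 3) + b by apply/(block011P n a bu); split.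
have h3 := sparse_odd_bin3 sa.
have -> : 2 ^ (u + 2) = 4 * 2 ^ u by rewrite expnD mulnC.
have uE : 2 ^ u.+1 = 2 * 2 ^ u by rewrite expnS.
move: {blk} nE bu; move: (2 ^ u) uE => U uE nE bu.
have UaE : U * (8 * a + 3) = 8 * (U * a) + 3 * U by rewrite mulnDr mulnCA mulnC [3 * _]mulnC.
have UaE2 : 2 * U * (3 * a) = 6 * (U * a) by rewrite mulnACA.
have UaE3 : 2 * U * (2 * a) = 4 * (U * a) by rewrite mulnACA.
rewrite UaE in nE.
have -> : n + (4 * U * a + (U - 1 - b)) - 1 = (2 ^ u.+1 * (3 * a) + (2 ^ u.+1 - 1)).*2.
  by rewrite uE UaE2 -mulnA; move: (U * a) nE => Ua; lia.
set M := (_ + _).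
have h k : k < 2 ^ u.+1 -> odd 'C(M.*2, (2 ^ u.+1 * (2 * a) + k).*2).
  by move=> ku; rewrite odd_bin_half !odd_double !doubleK odd_bin_exp2_pred.
have nE2 : n = 2 * (2 ^ u.+1 * (2 * a)) + (3 * U + b) by rewrite uE UaE3 nE; lia.
have MU : M.+1 = 6 * (U * a) + 2 * U by rewrite /M uE UaE2; lia.
rewrite uE UaE3 in nE2 h; move: (U * a) (M) MU nE nE2 h => Ua {UaE UaE2 UaE3}M MU nE nE2 h.
apply: admissible_pred; rewrite ?odd_double //; try lia.
- have := h (3 * U + b)./2 ltac:(lia).
  by congr (odd 'C(_, _)); lia.
- move=> en; have := h ((3 * U + b)./2 - 1) ltac:(lia).
  by congr (odd 'C(_, _)); lia.
Qed.

(** The highest pair of consecutive ones is preceded by a zero, possibly a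
    leading one, so it belongs to a block 011; hence there is no pair left above
    the highest block 011. *)
Lemma top_block n : consecutive_ones n ->
  block011 n (top011 n) /\ sparse (n %/ 2 ^ (top011 n + 3)).
Proof.
have ex_block m : consecutive_ones m -> exists2 i, i < m & block011 m i.
  case/existsP => i0 pi0.
  pose P i := bit m i && bit m i.+1.
  have exP : exists i, P i by exists i0.
  have ubP i : P i -> i <= m by move=> /andP[/bit_lt /ltnW].
  case: (ex_maxnP exP ubP) => i /andP[bi bi1] imax.
  have bi2 : ~~ bit m i.+2.
    by apply/negP => bi2; have := imax i.+1; rewrite /P bi1 bi2 => /(_ isT); lia.
  exists i; first exact: bit_lt.
  have : [&& bit (m %/ 2 ^ i) 0, bit (m %/ 2 ^ i) 1 & ~~ bit (m %/ 2 ^ i) 2].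
    by rewrite !bit_shift addn0 addn1 addn2 bi bi1.
  by rewrite /block011 /bit divn1; lia.
move=> cn; have [i im bi] := ex_block n cn.
have [u bu uE] : exists2 u : 'I_n, block011 n u & top011 n = u.
  rewrite /top011; have [|u] := @eq_bigmax_cond _ [pred u : 'I_n | block011 n u] (@nat_of_ord n).
    by apply/card_gt0P; exists (Ordinal im).
  by exists u.
rewrite uE; split=> //; apply/sparseP/negP => /ex_block[k km bk].
have bn : block011 n (u + 3 + k) by move: bk; rewrite /block011 -divnMA -expnD.
have kn : u + 3 + k < n.
  apply: leq_trans (ltn_expl _ (isT : 1 < 2)) _; rewrite leqNgt; apply/negP => lt.
  by move: bn; rewrite /block011 divn_small.
have := @leq_bigmax_cond _ [pred u : 'I_n | block011 n u] (@nat_of_ord n) (Ordinal kn) bn.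
by rewrite -/(top011 n) uE /=; lia.
Qed.

Lemma admissible_kappa n : 0 < n -> admissible n (n + kappa n - 1).
Proof.
move=> n0; rewrite /kappa.
case: ifPn => [/sparseP sn|/negPn cn].
  case: ifPn => [en|/negPn on]; last exact: admissible_sparse_odd.
  by rewrite addnA addn1 subn1; exact: admissible_sparse_even.
case: ifPn => [Ln|_].
  by apply: admissible_large => //; case/andP: (ndigitsP n0).
by have [] := top_block cn; exact: admissible_block.
Qed.

End BinomialParity.

(** * The coefficient attached to a Morin map *)

Section CharCoef.
Variables (J : eqType) (chi0 chi1 chi2 : J -> bool).
Local Notation coef := (char_coef chi0 chi1 chi2).

(** This is the binomial theorem for (x0 + x1)^p (x0 + x2)^q, by induction on p
    and q through Pascal's rule. *)
Lemma char_coef01_02 l1 l2 a b c :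
    {in l1, forall j, [/\ chi0 j, chi1 j & ~~ chi2 j]} ->
    {in l2, forall j, [/\ chi0 j, ~~ chi1 j & chi2 j]} ->
    (a + b + c = size l1 + size l2)%N ->
  coef (l1 ++ l2) a b c = ('C(size l1, b) * 'C(size l2, c))%:R.
Proof.
elim: l1 a b c => [|j l1 IH1] a b c h1 h2.
  elim: l2 a b c h2 => [|j l2 IH2] a b c h2 sz.
    by case: a b c sz => [|a] [|b] [|c].
  have [c0 /negbTE c1 c2] := h2 j (mem_head _ _).
  have {}IH2 a' b' c' := IH2 a' b' c' (fun k kl => h2 k (@mem_behead _ (j :: l2) k kl)).
  rewrite /= in IH2 sz.
  rewrite [LHS]/= c0 c1 c2.
  have -> : (if b is b'.+1 then false%:R * coef l2 a b' c else 0) = 0.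
    by case: (b) => // b'; rewrite mul0r.
  rewrite addr0 /=.
  case: b sz => [|b] sz; last first.
    rewrite !bin0n !mul0n.
    by case: a sz => [|a] sz; case: c sz => [|c] sz; rewrite ?mul1r ?IH2 ?bin0n ?mul0n ?addr0 //; lia.
  rewrite !bin0n !mul1n.
  case: a sz => [|a] sz; case: c sz => [|c] sz; try lia.
  - rewrite mul1r IH2 ?add0r ?mul1n; last lia.
    have -> : c = size l2 by lia.
    by rewrite !binn.
  - by rewrite mul1r IH2 ?addr0 ?bin0; last lia.
  - by rewrite !mul1r !IH2 ?mul1n; [rewrite binS natrD|lia|lia].
move=> sz; have [c0 c1 /negbTE c2] := h1 j (mem_head _ _).
have {}IH1 a' b' c' := IH1 a' b' c' (fun k kl => h1 k (@mem_behead _ (j :: l1) k kl)) h2.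
rewrite /= in sz; rewrite [LHS]/= c0 c1 c2.
have -> : (if c is c'.+1 then false%:R * coef (l1 ++ l2) a b c' else 0) = 0.
  by case: (c) => // c'; rewrite mul0r.
rewrite addr0 /=; case: a sz => [|a] sz; case: b sz => [|b] sz.
- by rewrite add0r bin0 bin_small ?muln0 //; lia.
- rewrite add0r mul1r IH1; last lia.
  rewrite binS mulnDl natrD; suff -> : ('C(size l1, b.+1) * 'C(size l2, c) = 0)%N by rewrite add0r.
  by case: (ltnP (size l1) b.+1) => h; [rewrite bin_small | rewrite [X in (_ * X)%N]bin_small ?muln0 //; lia].
- by rewrite addr0 mul1r IH1 ?bin0; last lia.
- by rewrite !mul1r !IH1 ?binS ?mulnDl ?natrD; [|lia|lia].
Qed.

Lemma char_coef12_01_02 j l1 l2 M a b c :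
    [/\ ~~ chi0 j, chi1 j & chi2 j] ->
    {in l1, forall j, [/\ chi0 j, chi1 j & ~~ chi2 j]} ->
    {in l2, forall j, [/\ chi0 j, ~~ chi1 j & chi2 j]} ->
    size l1 = M -> size l2 = M -> (a + b + c = M.*2.+1)%N ->
  coef (j :: l1 ++ l2) a b c = (pair_coef M b c)%:R.
Proof.
move=> [/negbTE c0 c1 c2] h1 h2 s1 s2 sz; rewrite /= c0 c1 c2 /pair_coef natrD.
have -> : (if a is a'.+1 then false%:R * coef (l1 ++ l2) a' b c else 0) = 0.
  by case: (a) => // a'; rewrite mul0r.
rewrite add0r; congr (_ + _).
  by case: b sz => // b sz; rewrite mul1r char_coef01_02 // s1 s2 //; lia.
by case: c sz => // c sz; rewrite mul1r char_coef01_02 // s1 s2 //; lia.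
Qed.

End CharCoef.

(** * A Borsuk-Ulam theorem for products of three spheres *)

Section CellPoints.
Variables (R : realType) (n N : nat).
Hypothesis N0 : (0 < N)%N.

(** The centre of a vertex or edge, rescaled so that the cube becomes [-1,
    1]^(n+1). *)
Definition cell_coord (e : int * bool) : R :=
  (e.1%:~R + (if e.2 then 2^-1 else 0)) / N%:R.

Definition cell_point (x : seq (int * bool)) : 'rV[R]_n.+1 :=
  \row_i cell_coord (nth (0, false) x i).

Let NR0 : 0 < N%:R :> R. Proof. by rewrite ltr0n. Qed.

Lemma cell_coord_opp e : cell_coord (opp1 e) = - cell_coord e.
Proof.
case: e => p []; rewrite /cell_coord /opp1 /= ?rmorphB ?rmorphN /= -mulNr; congr (_ / _).
  by field.
by rewrite !addr0.
Qed.

Lemma cell_point_opp x : cell_point (oppl x) = - cell_point x.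
Proof.
apply/rowP => i; rewrite !mxE -cell_coord_opp /oppl; congr cell_coord.
have [ix|xi] := ltnP i (size x); first by rewrite (nth_map (0, false)).
by rewrite !nth_default ?size_map // opp1_0.
Qed.

Lemma cell_coord_in_range e : in_range N e -> -1 <= cell_coord e <= 1.
Proof.
rewrite ler_pdivlMr // ler_pdivrMr // mulN1r mul1r -[N%:R]/(N%:Z%:~R) -rmorphN /=.
case: e => p [] /= /andP[/= p1 p2].
  have {p2} : p + 1 <= N%:Z by lia.
  rewrite -(ler_int R) rmorphD /= => p2; move: p1; rewrite -(ler_int R) => p1.
  by apply/andP; split; lra.
by rewrite addr0 !ler_int p1.
Qed.

Lemma cell_coord_pole : cell_coord (pole N) = 1.
Proof. by rewrite /cell_coord /= addr0 divff // gt_eqF. Qed.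

(** Cells of the cubical sphere have their centres on the unit sphere of the sup
    norm. *)
Lemma on_sphere_point x : on_sphere N n x ->
  (forall i, -1 <= cell_point x 0 i <= 1) /\ (exists i, `|cell_point x 0 i| = 1).
Proof.
case/and3P => /eqP sx /all_nthP ax /(has_nthP (0, false))[i ix hi]; split.
  by move=> j; rewrite mxE; apply: cell_coord_in_range; apply: ax; rewrite sx.
rewrite sx in ix; exists (Ordinal ix); rewrite mxE.
by case/orP: hi => /eqP ->; rewrite ?cell_coord_opp ?normrN cell_coord_pole normr1.
Qed.

Lemma on_sphere_point_neq0 x : on_sphere N n x -> cell_point x != 0.
Proof.
case/on_sphere_point => _ [i xi]; apply/eqP => x0; move: xi.
by rewrite x0 mxE normr0 => /eqP; rewrite eq_sym oner_eq0.
Qed.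

Lemma cell_coord_bd1 e e' : e' \in bd1 e -> `|cell_coord e - cell_coord e'| < N%:R^-1.
Proof.
case: e => p [] //=; rewrite !inE => /orP[] /eqP ->; rewrite /cell_coord /=.
  rewrite addr0 -mulrBl [_ + _ - _]addrAC subrr add0r normrM !ger0_norm ?invr_ge0 ?ler0n //.
  by rewrite gtr_pMl ?invr_gt0 // invf_lt1 ?ltr1n.
rewrite addr0 -mulrBl rmorphD /= opprD addrACA subrr add0r normrM [X in _ * X]ger0_norm ?invr_ge0 ?ler0n //.
rewrite gtr_pMl ?invr_gt0 // ltr_norml; apply/andP; split; lra.
Qed.

Lemma cell_point_bd x y : y \in bdl x -> ball (cell_point x) (N%:R^-1 : R) (cell_point y).
Proof.
move=> yx; have e0 : 0 < N%:R^-1 :> R by rewrite invr_gt0.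
split=> // i j; rewrite -ball_normE /ball_ /= !mxE; move: (nat_of_ord j) => k {i j}.
elim: x y yx k => [//|e x IH] y; rewrite mem_cat => /orP[] /mapP[z zx ->] [|k] /=.
- exact: cell_coord_bd1.
- by rewrite subrr normr0.
- by rewrite subrr normr0.
- exact: IH.
Qed.

Definition cell_point3 (p : seq (int * bool) * seq (int * bool) * seq (int * bool)) :
    'rV[R]_n.+1 * 'rV[R]_n.+1 * 'rV[R]_n.+1 :=
  (cell_point p.1.1, cell_point p.1.2, cell_point p.2).

Lemma cell_point3_reachable d p q : reachable bd3 d p q ->
  ball (cell_point3 p) (d.+1%:R / N%:R : R) (cell_point3 q).
Proof.
have e0 k : 0 < k.+1%:R / N%:R :> R by rewrite divr_gt0 // ltr0n.
elim: d p => [|d IH] p /=; first by rewrite orbF => /eqP ->; exact: ballxx.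
case/orP => [/eqP ->|/hasP[r rp /IH rq]]; first exact: ballxx.
rewrite -natr1 mulrDl addrC mul1r; apply: ball_triangle rq.
have e1 : 0 < N%:R^-1 :> R by rewrite invr_gt0.
move: rp; rewrite mem_cat => /orP[/mapP[y yp ->]|/mapP[z zx ->]].
  move: yp; rewrite mem_cat => /orP[] /mapP[z zx ->].
    split; [split|]; [exact: cell_point_bd|exact: ballxx|exact: ballxx].
  split; [split|]; [exact: ballxx|exact: cell_point_bd|exact: ballxx].
split; [exact: ballxx|exact: cell_point_bd].
Qed.

Lemma on_spheres_point_neq0 p : on_spheres N n p ->
  [/\ (cell_point3 p).1.1 != 0, (cell_point3 p).1.2 != 0 & (cell_point3 p).2 != 0].
Proof. by case/and3P => /on_sphere_point_neq0 ? /on_sphere_point_neq0 ? /on_sphere_point_neq0. Qed.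

End CellPoints.

Section BorsukUlam.
Variables (R : realType) (n : nat).
Local Notation V := 'rV[R]_n.+1.
Variables (J : eqType) (chi0 chi1 chi2 : J -> bool) (f : J -> V -> V -> V -> R).

(** The sign of the first nonzero coordinate: an arbitrary odd function,
    discontinuous but nowhere zero. *)
Definition lex_neg (x : V) : bool :=
  if [pick i | x 0 i != 0] is Some i then x 0 i < 0 else false.

Lemma lex_negN x : x != 0 -> lex_neg (- x) = ~~ lex_neg x.
Proof.
move=> x0; rewrite /lex_neg (eq_pick (Q := fun i => x 0 i != 0)); last first.
  by move=> i; rewrite mxE oppr_eq0.
case: pickP => [i xi|none]; first by rewrite mxE oppr_lt0 lt_neqAle eq_sym xi -leNgt.
by case/eqP: x0; apply/rowP => i; rewrite mxE; apply/eqP; have := none i; case: eqP.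
Qed.

(** Where f j vanishes its sign is not defined; there it is replaced by a
    product of signs of vectors that has the same behaviour under the three
    antipodes. *)
Definition sign_bit (j : J) (x u v : V) : bool :=
  if f j x u v == 0 then
    (chi0 j && lex_neg x) (+) (chi1 j && lex_neg u) (+) (chi2 j && lex_neg v)
  else f j x u v < 0.

Hypothesis f0 : forall j (x u v : V), x != 0 -> u != 0 -> v != 0 ->
  f j (- x) u v = (-1) ^+ chi0 j * f j x u v.
Hypothesis f1 : forall j (x u v : V), x != 0 -> u != 0 -> v != 0 ->
  f j x (- u) v = (-1) ^+ chi1 j * f j x u v.
Hypothesis f2 : forall j (x u v : V), x != 0 -> u != 0 -> v != 0 ->
  f j x u (- v) = (-1) ^+ chi2 j * f j x u v.

Let signM (b : bool) (y : R) : y != 0 -> ((-1) ^+ b * y < 0) = (y < 0) (+) b.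
Proof.
case: b => y0; rewrite ?expr1 ?expr0 ?mul1r ?addbF // mulN1r oppr_lt0 addbT.
by rewrite lt_neqAle eq_sym y0 -leNgt.
Qed.

Lemma sign_bit0 j (x u v : V) : x != 0 -> u != 0 -> v != 0 ->
  sign_bit j (- x) u v = sign_bit j x u v (+) chi0 j.
Proof.
move=> x0 u0 v0; rewrite /sign_bit f0 // mulf_eq0 signr_eq0 /=.
case: eqVneq => [_|fn0]; last exact: signM.
rewrite lex_negN //.
by case: (chi0 j); case: (lex_neg x); case: (chi1 j && _); case: (chi2 j && _).
Qed.

Lemma sign_bit1 j (x u v : V) : x != 0 -> u != 0 -> v != 0 ->
  sign_bit j x (- u) v = sign_bit j x u v (+) chi1 j.
Proof.
move=> x0 u0 v0; rewrite /sign_bit f1 // mulf_eq0 signr_eq0 /=.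
case: eqVneq => [_|fn0]; last exact: signM.
rewrite lex_negN //.
by case: (chi1 j); case: (lex_neg u); case: (chi0 j && _); case: (chi2 j && _).
Qed.

Lemma sign_bit2 j (x u v : V) : x != 0 -> u != 0 -> v != 0 ->
  sign_bit j x u (- v) = sign_bit j x u v (+) chi2 j.
Proof.
move=> x0 u0 v0; rewrite /sign_bit f2 // mulf_eq0 signr_eq0 /=.
case: eqVneq => [_|fn0]; last exact: signM.
rewrite lex_negN //.
by case: (chi2 j); case: (lex_neg v); case: (chi1 j && _); case: (chi0 j && _).
Qed.

Hypothesis f_cont : forall j (x u v : V), x != 0 -> u != 0 -> v != 0 ->
  {for (x, u, v), continuous (fun p : V * V * V => f j p.1.1 p.1.2 p.2)}.

(** The discrete theorem, applied to finer and finer grids, gives cells near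
    which every f j takes both signs; by compactness their centres have a
    cluster point, whose coordinates are nonzero vectors. If f j did not vanish
    there, it would have a constant sign on a neighbourhood. *)
Theorem product_borsuk_ulam l a b c : (a <= n)%N -> (b <= n)%N -> (c <= n)%N ->
    size l = (a + b + c)%N -> char_coef chi0 chi1 chi2 l a b c != 0 ->
  exists x u v, [/\ x != 0, u != 0, v != 0 & {in l, forall j, f j x u v = 0}].
Proof.
move=> an bn cn szl nz.
pose s N j p : 'F_2 :=
  let z := cell_point3 R n N p in (sign_bit j z.1.1 z.1.2 z.2)%:R.
have /choice[P Pprop] : forall N, exists p, on_spheres N.+1 n p /\
    forall j, j \in l -> exists q r,
      [/\ reachable bd3 (size l) p q, reachable bd3 (size l) p r & s N.+1 j q != s N.+1 j r].
  move=> N; have [] := @discrete_borsuk_ulam N.+1 n J chi0 chi1 chi2 (s N.+1) _ _ _ l a b c an bn cn szl nz.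
  - move=> j p /(on_spheres_point_neq0 R (ltn0Sn N))[x0 u0 v0].
    by rewrite /s /cell_point3 /= cell_point_opp sign_bit0 // F2_addb.
  - move=> j p /(on_spheres_point_neq0 R (ltn0Sn N))[x0 u0 v0].
    by rewrite /s /cell_point3 /= cell_point_opp sign_bit1 // F2_addb.
  - move=> j p /(on_spheres_point_neq0 R (ltn0Sn N))[x0 u0 v0].
    by rewrite /s /cell_point3 /= cell_point_opp sign_bit2 // F2_addb.
  by move=> p Pp hp; exists p.
pose z N := cell_point3 R n N.+1 (P N).
pose B := [set v : V | forall i, `[(-1 : R), 1]%classic (v ord0 i)]%classic.
have cB : compact B.
  apply: (@rV_compact R n.+1 (fun=> `[(-1 : R), 1]%classic)) => i.
  exact: segment_compact.
have zB N : ((B `*` B) `*` B)%classic (z N).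
  have [/and3P[s0 s1 s2] _] := Pprop N.
  split; [split|] => i /=; rewrite in_itv /=.
  - by have [] := on_sphere_point R (ltn0Sn N) s0.
  - by have [] := on_sphere_point R (ltn0Sn N) s1.
  - by have [] := on_sphere_point R (ltn0Sn N) s2.
have cBBB : compact ((B `*` B) `*` B) by do !apply: compact_setX.
have [|w [wB clw]] := cBBB (z @ \oo)%classic _.
  by exists 0%N => // N _; exact: zB.
(* Any neighbourhood of w contains centres of cells of arbitrarily small mesh. *)
have near_w (N0 : nat) (e : R) : 0 < e -> exists2 N, (N0 <= N)%N & ball w e (z N).
  move=> e0; have [||_ [[N N0N <-] wz]] := clw (z @` [set N | (N0 <= N)%N])%classic (ball w e).
  - by exists N0 => // N; exists N.
  - exact: nbhsx_ballx.
  by exists N.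
have nzw (g : V * V * V -> V) : (forall e y, ball w e y -> ball (g w) e (g y)) ->
    (forall N, exists i, `|g (z N) 0 i| = 1) -> g w != 0.
  move=> gb gz; apply/eqP => g0; have [N _ /gb[_]] := near_w 0%N 1 ltr01.
  have [i gi] := gz N => /(_ 0 i); rewrite -ball_normE /= g0 mxE sub0r normrN gi.
  by rewrite ltxx.
have [x0 u0 v0] : [/\ w.1.1 != 0, w.1.2 != 0 & w.2 != 0].
  split.
  - apply: (nzw (fun p => p.1.1)) => [e y [[]]//|N].
    have [/and3P[s0 s1 s2] _] := Pprop N.
    by have [] := on_sphere_point R (ltn0Sn N) s0.
  - apply: (nzw (fun p => p.1.2)) => [e y [[]]//|N].
    have [/and3P[s0 s1 s2] _] := Pprop N.
    by have [] := on_sphere_point R (ltn0Sn N) s1.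
  - apply: (nzw (fun p => p.2)) => [e y []//|N].
    have [/and3P[s0 s1 s2] _] := Pprop N.
    by have [] := on_sphere_point R (ltn0Sn N) s2.
exists w.1.1, w.1.2, w.2; split=> // j jl; apply/eqP/negPn/negP => fn0.
pose F (p : V * V * V) := f j p.1.1 p.1.2 p.2.
have Fpos : \forall p \near w, 0 < F w * F p.
  have Fc : {for w, continuous F} by move: (f_cont (j := j) x0 u0 v0); rewrite -!surjective_pairing.
  have Gc : {for w, continuous (fun p => F w * F p)}.
    by apply: cvgM => //; exact: cvg_cst.
  have Fw2 : 0 < F w * F w by rewrite -expr2 exprn_even_gt0.
  exact: Gc (lt_nbhsr Fw2).
have [e /= e0 eF] := proj1 (nbhs_ballP _ _) Fpos.
pose D : R := (size l).+1%:R.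
have [N0 N0e] : exists N0 : nat, D / (e / 2) < N0%:R.
  by exists (Num.truncn (D / (e / 2))).+1; exact: truncnS_gt.
have [N N0N wN] := near_w N0 (e / 2) (divr_gt0 e0 (ltr0Sn _ _)).
have De : D / N.+1%:R < e / 2.
  rewrite ltr_pdivrMr ?ltr0n // mulrC -ltr_pdivrMr ?divr_gt0 //.
  by apply: lt_le_trans N0e _; rewrite ler_nat ltnW.
(* Both the centre of the cell and the cells reached from it lie in a ball around w on
   which f j keeps its sign. *)
have sE q : reachable bd3 (size l) (P N) q -> s N.+1 j q = (F w < 0)%R%:R.
  move=> /(cell_point3_reachable R n (ltn0Sn N)) bq.
  have : ball w e (cell_point3 R n N.+1 q).
    rewrite [e]splitr; apply: ball_triangle wN _.
    by apply: le_ball bq; exact: ltW.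
  move=> /eF /=; rewrite /s; set y := cell_point3 _ _ _ _ => Fy.
  have Fy0 : F y != 0 by apply: contraTneq Fy => ->; rewrite mulr0 ltxx.
  have -> : sign_bit j y.1.1 y.1.2 y.2 = (F y < 0).
    by rewrite /sign_bit (negbTE (Fy0 : f j _ _ _ != 0)).
  congr (_%:R); case: (ltgtP (F w) 0) (fn0 : F w != 0) => // Fw _.
    by rewrite nmulr_rgt0 // in Fy; rewrite Fy.
  by rewrite pmulr_rgt0 // in Fy; rewrite ltNge ltW.
have [_ /(_ j jl)[q [r [/sE -> /sE ->]]]] := Pprop N.
by rewrite eqxx.
Qed.

End BorsukUlam.

(** * The differential of a map of projective space in homogeneous coordinates *)

Section HomogeneousMap.
Variables (R : realType) (n m : nat).
Local Notation V := 'rV[R]_n.+1.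
Implicit Types (i : 'I_n.+1) (x u v : V).

Definition chart (i : 'I_n.+1) (x : V) : 'rV[R]_n :=
  \row_k (x 0 (lift i k) / x 0 i).

(** The derivative at x in the direction u of the i-th affine chart. *)
Definition chart_slope (i : 'I_n.+1) (x u : V) : 'rV[R]_n :=
  \row_k ((u 0 (lift i k) * x 0 i - x 0 (lift i k) * u 0 i) / x 0 i ^+ 2).

Lemma rp_param_chart i x : x 0 i != 0 -> val (rp_param i (chart i x)) = <[x]>%VS.
Proof.
move=> xi; have aE : affine_vec i (chart i x) = (x 0 i)^-1 *: x.
  apply/rowP => j; rewrite !mxE; case: unliftP => [k ->|->]; first by rewrite mxE mulrC.
  by rewrite mulVf.
have x0 : x != 0 by apply: contraNneq xi => ->; rewrite mxE.
rewrite /= aE; apply/eqP; rewrite eqEdim !dim_vline scaler_eq0 invr_eq0 (negbTE xi) x0 leqnn andbT.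
by rewrite -memvE memvZ // memv_line.
Qed.

(** A projective chart maps lines to lines: it sends the line through x directed
    by u to the line through the image of x directed by the slope, with a
    reparametrization whose derivative at 0 is 1. *)
Lemma chart_line i x u (h : R) : x 0 i != 0 -> x 0 i + h * u 0 i != 0 ->
  chart i (h *: u + x) =
  chart i x + (h * x 0 i / (x 0 i + h * u 0 i)) *: chart_slope i x u.
Proof.
by move=> xi xhi; apply/rowP => k; rewrite !mxE; field; rewrite ?[_ + x 0 i]addrC ?xhi ?xi.
Qed.

Lemma chart_slopeN i x u : chart_slope i x (- u) = - chart_slope i x u.
Proof. by apply/rowP => k; rewrite !mxE mulNr mulrN -opprD mulNr. Qed.

Lemma chart_slopeNx i x u : chart_slope i (- x) u = - chart_slope i x u.
Proof. by apply/rowP => k; rewrite !mxE sqrrN; ring. Qed.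

Lemma chartN i x : chart i (- x) = chart i x.
Proof. by apply/rowP => k; rewrite !mxE invrN mulrNN. Qed.

Lemma chart_slope_lin i x (a b : R) u v :
  chart_slope i x (a *: u + b *: v) = a *: chart_slope i x u + b *: chart_slope i x v.
Proof. by apply/rowP => k; rewrite !mxE; ring. Qed.

(** The kernel of the differential of the projection to projective space is the
    line itself. *)
Lemma chart_slope_eq0 i x u : x 0 i != 0 -> chart_slope i x u = 0 -> u = (u 0 i / x 0 i) *: x.
Proof.
move=> xi /rowP su; apply/rowP => j; rewrite mxE; case: (unliftP i j) => [k ->|->]; last by rewrite divfK.
have /eqP := su k; rewrite !mxE mulf_eq0 invr_eq0 expf_eq0 (negbTE xi) orbF subr_eq0 => /eqP e.
by rewrite mulrAC [u 0 i * _]mulrC -e mulfK.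
Qed.

Variable f : RP R n -> 'rV[R]_m.

(** The map on the complement of 0 in R^(n+1) that is constant on lines and
    induces f. *)
Definition cone_map (x : V) : 'rV[R]_m :=
  if [pick i | x 0 i != 0] is Some i then f (rp_param i (chart i x)) else 0.

Lemma cone_mapE i x : x 0 i != 0 -> cone_map x = f (rp_param i (chart i x)).
Proof.
move=> xi; rewrite /cone_map; case: pickP => [j xj|/(_ i)]; last by rewrite xi.
by congr f; apply: val_inj; rewrite !rp_param_chart.
Qed.

(** The curve h |-> x + h u is seen in the chart as a reparametrized straight
    line, so that only the chain rule along a curve is needed. *)
Lemma derive_cone_map i x u : x 0 i != 0 ->
    differentiable (f \o rp_param i) (chart i x) ->
  'D_u cone_map x = 'd (f \o rp_param i) (chart i x) (chart_slope i x u).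
Proof.
move=> xi dg; set g := f \o _ in dg *; set y := chart i x in dg *; set w := chart_slope i x u.
pose K (h : R) := cone_map (h *: u + x).
(* The line in the chart along which the cone map moves. *)
pose c (h : R) : 'rV[R]_n := y + (h * x 0 i / (x 0 i + h * u 0 i)) *: w.
have DK : 'D_u cone_map x = derive1 K 0.
  rewrite /derive /derive1.
  rewrite (_ : (fun h => _) = (fun h : R => h^-1 *: (K (h + 0) - K 0))) //.
  by apply/funext => h; rewrite /K /= addr0 scale0r add0r.
have den : (x 0 i + h * u 0 i) @[h --> (0 : R)] --> x 0 i.
  rewrite -[X in _ --> X]addr0 -[X in _ --> _ + X](mul0r (u 0 i)).
  by apply: cvgD; [exact: cvg_cst | apply: cvgM; [exact: cvg_id | exact: cvg_cst]].
have nz : \forall h \near (0 : R), x 0 i + h * u 0 i != 0 by exact: cvgr_neq0 den xi.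
have KG : \forall h \near (0 : R), K h = (g \o c) h.
  near=> h; have h0 : x 0 i + h * u 0 i != 0 by near: h.
  rewrite /K (cone_mapE (i := i)) ?chart_line //.
  by rewrite !mxE addrC.
have c0 : c 0 = y by rewrite /c !mul0r scale0r addr0.
have dc : h^-1 *: (c (h + 0) - c 0) @[h --> (0 : R)^'] --> w.
  have lim1 : (x 0 i / (x 0 i + h * u 0 i)) *: w @[h --> (0 : R)^'] --> w.
    have we : w = (x 0 i / x 0 i) *: w by rewrite divff // scale1r.
    rewrite [X in _ --> X]we.
    apply: cvgZr_tmp; apply: cvgM; first exact: cvg_cst.
    by apply: cvgV => //; apply: cvg_within_filter; exact: den.
  apply: cvg_trans lim1; apply: near_eq_cvg; near=> h.
  have h0 : h != 0 by near: h; exact: nbhs_dnbhs_neq.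
  rewrite addr0 c0 /c addrAC subrr add0r scalerA; congr (_ *: _).
  by rewrite -mulrA mulKf.
have cD : derivable c 0 1.
  apply/cvg_ex; exists w; rewrite (_ : (fun h => _) = (fun h : R => h^-1 *: (c (h + 0) - c 0))) //.
  apply/funext => h /=.
  by rewrite /GRing.scale /= mulr1.
have dcd : differentiable c 0 by apply/derivable1_diffP.
have c1 : 'd c 0 1 = w.
  by rewrite -derive1E' //; exact: cvg_lim dc.
rewrite DK derive1E (near_eq_derive _ KG) -derive1E derive1E'; last first.
  by apply: differentiable_comp => //; rewrite c0.
by rewrite diff_comp ?c0 //= c1.
Unshelve. all: by end_near. Qed.

End HomogeneousMap.

(** * The family of linear maps defined by a Morin map *)

(** Where g is not differentiable, 'd g y is by convention the zero map, whose
    kernel is the whole space R^n. In dimension n > 1 a kernel of dimension at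
    most 1 thus forces differentiability. *)
Lemma differentiable_lker_small (R : realType) (n m : nat)
    (g : 'rV[R]_n -> 'rV[R]_m) (y : 'rV[R]_n) :
  (1 < n)%N -> (\dim (lker (linfun ('d g y))) <= 1)%N -> differentiable g y.
Proof.
move=> n1 dk; apply/diffP.
pose Q (df : {linear 'rV[R]_n -> 'rV[R]_m}) := continuous df /\ forall x,
  g x = g (lim (nbhs y)) + df (x - lim (nbhs y)) +o_(x \near nbhs y) (x - lim (nbhs y)).
have [exQ|noQ] := pselect (exists df, Q df); first exact: (getPex exQ).
have d0 z : 'd g y z = 0.
  by rewrite /diff getPN // => df Qdf; apply: noQ; exists df.
move: dk; have -> : lker (linfun ('d g y)) = fullv.
  by apply/vspaceP => z; rewrite memvf memv_ker lfunE /= d0 eqxx.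
by rewrite dimvf /dim /= mul1n leqNgt n1.
Qed.

Lemma cvg_rV (R : realType) (T : Type) (F : set_system T) (n : nat)
    (h : T -> 'rV[R]_n) (l : 'rV[R]_n) : Filter F ->
  (forall k, h t 0 k @[t --> F] --> l 0 k) -> h t @[t --> F] --> l.
Proof.
move=> FF hl A [P lP PA]; rewrite /nbhs /=.
have : F [set t | forall k, P 0 k (h t 0 k)].
  by apply: filter_forall => k; exact: hl (lP 0 k).
by apply: filterS => t Pt; apply: PA => i j; rewrite ord1; exact: Pt.
Qed.

Lemma cvg_coord1 (R : realType) (n : nat) (x u : 'rV[R]_n) l :
  (p.1 : 'rV[R]_n) 0 l @[p --> (x, u)] --> x 0 l.
Proof.
apply: (@cvg_comp _ _ _ fst (fun M : 'rV[R]_n => M 0 l) _ (nbhs x)).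
  exact: cvg_fst.
exact: coord_continuous.
Qed.

Lemma cvg_coord2 (R : realType) (n : nat) (x u : 'rV[R]_n) l :
  (p.2 : 'rV[R]_n) 0 l @[p --> (x, u)] --> u 0 l.
Proof.
apply: (@cvg_comp _ _ _ snd (fun M : 'rV[R]_n => M 0 l) _ (nbhs u)).
  exact: cvg_snd.
exact: coord_continuous.
Qed.

Lemma cvg_sumr (R : realType) (T : Type) (F : set_system T) (I : Type) (r : seq I)
    (h : I -> T -> R) (l : I -> R) : Filter F ->
  (forall i, h i t @[t --> F] --> l i) ->
  \sum_(i <- r) h i t @[t --> F] --> \sum_(i <- r) l i.
Proof. by move=> FF hl; apply: cvg_big => //; exact: add_continuous. Qed.

Section DotProduct.
Variables (R : realType) (n : nat).
Implicit Types (x u v : 'rV[R]_n).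

Definition dotr x u : R := \sum_i x 0 i * u 0 i.

Lemma neq0_coord x : x != 0 -> exists i, x 0 i != 0.
Proof.
move=> x0; apply/existsP; apply: contraNT x0; rewrite negb_exists => /forallP h.
by apply/eqP/rowP => j; rewrite mxE; apply/eqP; have := h j; rewrite negbK.
Qed.

Lemma dotrC x u : dotr x u = dotr u x.
Proof. by apply: eq_bigr => i _; rewrite mulrC. Qed.

Lemma dotrDr x u v (a b : R) : dotr x (a *: u + b *: v) = a * dotr x u + b * dotr x v.
Proof.
rewrite /dotr !mulr_sumr -big_split; apply: eq_bigr => i _.
by rewrite !mxE /=; ring.
Qed.

Lemma dotrZr x u (a : R) : dotr x (a *: u) = a * dotr x u.
Proof. by rewrite /dotr mulr_sumr; apply: eq_bigr => i _; rewrite !mxE; ring. Qed.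

Lemma dotr_eq0 x : dotr x x = 0 -> x = 0.
Proof.
move=> /eqP; rewrite psumr_eq0 => [/allP h|i _]; last by rewrite -expr2 sqr_ge0.
apply/rowP => i; rewrite mxE; apply/eqP.
by have := h i (mem_index_enum i); rewrite mulf_eq0 orbb.
Qed.

Lemma dotr_continuous (p : 'rV[R]_n * 'rV[R]_n) :
  {for p, continuous (fun q : 'rV[R]_n * 'rV[R]_n => dotr q.1 q.2)}.
Proof.
case: p => x u; apply: cvg_sumr => i.
by apply: cvgM; [exact: cvg_coord1 | exact: cvg_coord2].
Qed.

End DotProduct.

Section MorinFamily.
Variables (R : realType) (n m : nat) (f : RP R n -> 'rV[R]_m).
Local Notation V := 'rV[R]_n.+1.
Implicit Types (i : 'I_n.+1) (x u v : V).
Hypotheses (n1 : (1 < n)%N) (fM : Morin f).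

Lemma Morin_differentiable i y : differentiable (f \o rp_param i) y.
Proof. by apply: differentiable_lker_small => //; exact: (proj2 fM) erefl. Qed.

Lemma Morin_derive i x u : x 0 i != 0 ->
  'D_u (cone_map f) x = 'd (f \o rp_param i) (chart i x) (chart_slope i x u).
Proof. by move=> xi; apply: derive_cone_map xi _; exact: Morin_differentiable. Qed.

(** The expression in terms of the first partial derivatives, which are
    continuous by smoothness; this is the source of the continuity of the
    differential in both arguments. *)
Lemma Morin_deriveE i x u : x 0 i != 0 ->
  'D_u (cone_map f) x =
  \sum_k chart_slope i x u 0 k *: partials [:: k] (f \o rp_param i) (chart i x).
Proof.
move=> xi; rewrite (Morin_derive _ xi) [in LHS](row_sum_delta (chart_slope i x u)) linear_sum.
apply: eq_bigr => k _; rewrite linearZ /= deriveE //; exact: Morin_differentiable.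
Qed.

Lemma derive_cone_mapN x u : x != 0 -> 'D_u (cone_map f) (- x) = - 'D_u (cone_map f) x.
Proof.
move=> /neq0_coord[i xi]; have xi' : (- x) 0 i != 0 by rewrite mxE oppr_eq0.
by rewrite !(Morin_derive _ (i := i)) // chart_slopeNx chartN linearN.
Qed.

Lemma derive_cone_map_oppr x u : x != 0 -> 'D_(- u) (cone_map f) x = - 'D_u (cone_map f) x.
Proof.
move=> /neq0_coord[i xi].
by rewrite !(Morin_derive _ (i := i)) // chart_slopeN linearN.
Qed.

(** If u and v were solutions, the images of u and v in the chart would be
    dependent, as they lie in a kernel of dimension at most 1; so a combination
    of u and v would be proportional to x. It is also orthogonal to x, hence
    zero, which is impossible for orthogonal nonzero vectors. *)
Lemma Morin_kernel x u v : x != 0 -> u != 0 -> v != 0 ->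
    'D_u (cone_map f) x = 0 -> dotr x u = 0 ->
    'D_v (cone_map f) x = 0 -> dotr x v = 0 -> dotr u v <> 0.
Proof.
move=> x0 u0 v0 du xu dv xv uv; have [i xi] := neq0_coord x0.
set K := lker (linfun ('d (f \o rp_param i) (chart i x))).
have dimK : (\dim K <= 1)%N by exact: (proj2 fM) erefl.
have wK w : 'D_w (cone_map f) x = 0 -> chart_slope i x w \in K.
  by move=> dw; rewrite memv_ker lfunE /= -Morin_derive // dw.
have [a [b [ab0 lin]]] : exists a b : R,
    (a != 0) || (b != 0) /\ a *: chart_slope i x u + b *: chart_slope i x v = 0.
  have [su|su] := eqVneq (chart_slope i x u) 0.
    by exists 1, 0; rewrite oner_eq0 su scaler0 scale0r addr0.
  have : chart_slope i x v \in <[chart_slope i x u]>%VS.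
    suff <- : K = <[chart_slope i x u]>%VS by exact: wK.
    apply/esym/eqP; rewrite eqEdim -memvE wK //=.
    by rewrite dim_vline su.
  case/vlineP => k ->; exists k, (-1); rewrite oppr_eq0 oner_eq0 orbT; split=> //.
  by rewrite scaleN1r subrr.
move: lin; rewrite -chart_slope_lin => /(chart_slope_eq0 xi); set c := (_ / _) => e.
have c0 : c = 0.
  have : dotr x (a *: u + b *: v) = 0 by rewrite dotrDr xu xv !mulr0 addr0.
  rewrite e dotrZr => /eqP; rewrite mulf_eq0 => /orP[/eqP //|/eqP /dotr_eq0 xE].
  by rewrite xE eqxx in x0.
rewrite c0 scale0r in e.
have au : a * dotr u u = 0.
  by have := dotrDr u u v a b; rewrite e uv mulr0 addr0 => <-; rewrite -(scale0r u) dotrZr mul0r.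
have bv : b * dotr v v = 0.
  by have := dotrDr v u v a b; rewrite e (dotrC v u) uv mulr0 add0r => <-; rewrite -(scale0r u) dotrZr mul0r.
case/orP: ab0 => h.
  by move/eqP: au; rewrite mulf_eq0 (negbTE h) => /eqP /dotr_eq0 uE; rewrite uE eqxx in u0.
by move/eqP: bv; rewrite mulf_eq0 (negbTE h) => /eqP /dotr_eq0 vE; rewrite vE eqxx in v0.
Qed.

Lemma derive_cone_map_continuous (j : 'I_m) x u : x != 0 ->
  {for (x, u), continuous (fun p : V * V => ('D_p.2 (cone_map f) p.1) 0 j)}.
Proof.
move=> /neq0_coord[i xi].
have c1 := @cvg_coord1 R n.+1 x u; have c2 := @cvg_coord2 R n.+1 x u.
have nz : \forall p \near (x, u), (p.1 : V) 0 i != 0 by exact: cvgr_neq0 (c1 i) xi.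
have cs k : chart_slope i p.1 p.2 0 k @[p --> (x, u)] --> chart_slope i x u 0 k.
  rewrite mxE; under eq_fun do rewrite mxE.
  apply: cvgM; first by apply: cvgB; apply: cvgM.
  by apply: cvgV; rewrite ?expf_neq0 //; apply: cvgM.
have cc : chart i (p.1 : V) @[p --> (x, u)] --> chart i x.
  apply: cvg_rV => k; rewrite mxE; under eq_fun do rewrite mxE.
  by apply: cvgM => //; apply: cvgV.
have cp k : (partials [:: k] (f \o rp_param i) (chart i p.1)) 0 j @[p --> (x, u)] -->
    (partials [:: k] (f \o rp_param i) (chart i x)) 0 j.
  have cg : {for chart i x, continuous
      (fun y => (partials [:: k] (f \o rp_param i) y : 'rV[R]_m) 0 j)}.
    apply: (continuous_comp (f := partials [:: k] (f \o rp_param i))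
                            (g := fun M : 'rV[R]_m => M 0 j)).
      exact: (proj1 (proj1 fM i [:: k])).
    exact: coord_continuous.
  exact: (cvg_comp (fun p : V * V => chart i p.1) _ cc cg).
have lim1 : \sum_k chart_slope i p.1 p.2 0 k * (partials [:: k] (f \o rp_param i) (chart i p.1)) 0 j
    @[p --> (x, u)] -->
    \sum_k chart_slope i x u 0 k * (partials [:: k] (f \o rp_param i) (chart i x)) 0 j.
  by apply: cvg_sumr => k; apply: cvgM.
have nE : \forall p \near (x, u),
    \sum_k chart_slope i p.1 p.2 0 k * (partials [:: k] (f \o rp_param i) (chart i p.1)) 0 j =
    ('D_p.2 (cone_map f) p.1) 0 j.
  near=> p; rewrite (Morin_deriveE _ (i := i)); last by near: p.
  by rewrite summxE; apply: eq_bigr => k _; rewrite [RHS]mxE.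
have dE : ('D_u (cone_map f) x) 0 j =
    \sum_k chart_slope i x u 0 k * (partials [:: k] (f \o rp_param i) (chart i x)) 0 j.
  by rewrite (Morin_deriveE _ xi) summxE; apply: eq_bigr => k _; rewrite [LHS]mxE.
rewrite /prop_for /continuous_at /= dE.
exact: cvg_trans (near_eq_cvg nE) lim1.
Unshelve. all: by end_near. Qed.

End MorinFamily.

(** * Nonexistence *)

Section Obstruction.
Variables (R : realType) (n m : nat) (f : RP R n -> 'rV[R]_m).
Local Notation V := 'rV[R]_n.+1.
Hypotheses (n1 : (1 < n)%N) (fM : Morin f).

(** The coordinates of the linear map u |-> (D_u F(x), <x, u>). The last
    coordinate makes up for the fact that F is constant along x. *)
Definition augmented_diff (k : 'I_m.+1) (x u : V) : R :=
  if unlift ord_max k is Some j then ('D_u (cone_map f) x) 0 j else dotr x u.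

Lemma augmented_diffN k x u : x != 0 ->
  augmented_diff k (- x) u = - augmented_diff k x u.
Proof.
move=> x0; rewrite /augmented_diff; case: unliftP => [j _|_].
  by rewrite derive_cone_mapN // mxE.
by rewrite -scaleN1r dotrC dotrZr dotrC mulN1r.
Qed.

Lemma augmented_diff_oppr k x u : x != 0 ->
  augmented_diff k x (- u) = - augmented_diff k x u.
Proof.
move=> x0; rewrite /augmented_diff; case: unliftP => [j _|_].
  by rewrite derive_cone_map_oppr // mxE.
by rewrite -scaleN1r dotrZr mulN1r.
Qed.

Lemma augmented_diff_continuous k x u : x != 0 ->
  {for (x, u), continuous (fun p : V * V => augmented_diff k p.1 p.2)}.
Proof.
move=> x0; rewrite /augmented_diff; case: unliftP => [j _|_].
  exact: derive_cone_map_continuous.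
exact: dotr_continuous.
Qed.

Lemma augmented_diff_eq0 x u : (forall k, augmented_diff k x u = 0) ->
  'D_u (cone_map f) x = 0 /\ dotr x u = 0.
Proof.
move=> h; split; last by have := h ord_max; rewrite /augmented_diff unlift_none.
by apply/rowP => j; have := h (lift ord_max j); rewrite /augmented_diff liftK mxE.
Qed.

Local Notation label := (option (bool * 'I_m.+1)).

(** The label None stands for the equation <u, v> = 0, and (b, k) for the k-th
    coordinate of A(x)u if b, of A(x)v otherwise. *)
Definition label_char0 (j : label) : bool := isSome j.
Definition label_char1 (j : label) : bool := if j is Some (b, _) then b else true.
Definition label_char2 (j : label) : bool := if j is Some (b, _) then ~~ b else true.

Definition label_fun (j : label) (x u v : V) : R :=
  if j is Some (b, k) then augmented_diff k x (if b then u else v) else dotr u v.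

Lemma label_fun_continuous j x u v : x != 0 -> u != 0 -> v != 0 ->
  {for (x, u, v), continuous (fun p : V * V * V => label_fun j p.1.1 p.1.2 p.2)}.
Proof.
move=> x0 _ _.
have c1 : p.1 @[p --> (x, u, v)] --> (x, u) by exact: cvg_fst.
have c11 : p.1.1 @[p --> (x, u, v)] --> x by apply: (cvg_comp fst fst c1); exact: cvg_fst.
have c12 : p.1.2 @[p --> (x, u, v)] --> u by apply: (cvg_comp fst snd c1); exact: cvg_snd.
have c2 : p.2 @[p --> (x, u, v)] --> v by exact: cvg_snd.
case: j => [[[] k]|] /=.
- exact: (cvg_comp fst (fun q : V * V => augmented_diff k q.1 q.2) c1
    (augmented_diff_continuous (k := k) (u := u) x0)).
- apply: (cvg_comp (fun p : V * V * V => (p.1.1, p.2)) (fun q : V * V => augmented_diff k q.1 q.2) _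
    (augmented_diff_continuous (k := k) (u := v) x0)).
  exact: (cvg_pair c11 c2).
- apply: (cvg_comp (fun p : V * V * V => (p.1.2, p.2)) (fun q : V * V => dotr q.1 q.2) _
    (@dotr_continuous R n.+1 (u, v))).
  exact: (cvg_pair c12 c2).
Qed.

(** The system of 2M + 1 equations, in which coordinates of A(x) are repeated
    when M > m + 1, has a solution by the Borsuk-Ulam theorem, against the
    injectivity of A(x) modulo a line. *)
Lemma Morin_not_admissible M : (m < M)%N -> ~ admissible n M.
Proof.
move=> mM [b [c [bn cn /andP[bc1 bc2] odd_coef]]].
(* Values i > m are sent by inord to 0 and repeat one of the equations. *)
pose l1 : seq label := [seq Some (true, inord i) | i <- iota 0 M].
pose l2 : seq label := [seq Some (false, inord i) | i <- iota 0 M].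
have := @product_borsuk_ulam R n _ label_char0 label_char1 label_char2 label_fun
  _ _ _ label_fun_continuous (None :: l1 ++ l2) (M.*2.+1 - b - c)%N b c.
case.
- move=> [[[] k]|] x u v x0 u0 v0 /=; rewrite ?expr1 ?expr0 ?mulN1r ?mul1r //;
  exact: augmented_diffN.
- move=> [[[] k]|] x u v x0 u0 v0 /=; rewrite ?expr1 ?expr0 ?mulN1r ?mul1r //.
    exact: augmented_diff_oppr.
  by rewrite -scaleN1r dotrC dotrZr dotrC mulN1r.
- move=> [[[] k]|] x u v x0 u0 v0 /=; rewrite ?expr1 ?expr0 ?mulN1r ?mul1r //.
    exact: augmented_diff_oppr.
  by rewrite -scaleN1r dotrZr mulN1r.
- lia.
- by [].
- by [].
- by rewrite /= size_cat !size_map !size_iota; lia.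
- rewrite (char_coef12_01_02 (M := M)) ?F2_natr_odd ?size_map ?size_iota //.
  + by move=> j /mapP[i _ ->].
  + by move=> j /mapP[i _ ->].
  + lia.
move=> x [u [v [x0 u0 v0 zero]]].
have mem_iota_ord (k : 'I_m.+1) : exists2 i, i \in iota 0 M & k = inord i.
  by exists (nat_of_ord k); rewrite ?inord_val // mem_iota /=; have := ltn_ord k; lia.
have [du xu] : 'D_u (cone_map f) x = 0 /\ dotr x u = 0.
  apply: augmented_diff_eq0 => k; apply: (zero (Some (true, k))).
  have [i iM ->] := mem_iota_ord k.
  by rewrite inE mem_cat /l1 map_f ?orbT.
have [dv xv] : 'D_v (cone_map f) x = 0 /\ dotr x v = 0.
  apply: augmented_diff_eq0 => k; apply: (zero (Some (false, k))).
  have [i iM ->] := mem_iota_ord k.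
  by rewrite inE mem_cat /l2 map_f ?orbT.
exact: (Morin_kernel n1 fM x0 u0 v0 du xu dv xv (zero None (mem_head _ _))).
Qed.

End Obstruction.

Lemma kappa1 : kappa 1 = 0%N.
Proof.
by rewrite /kappa; case: ifPn => // /negPn /existsP[[[|i] //= _]].
Qed.

Theorem corollary5p10 (R : realType) (n : nat) (hn : (1 <= n)%N)
    (k : int) (m : nat) (hm : m%:Z = n%:Z + k)
    (hf : exists f : RP R n -> 'rV[R]_m, Morin f) :
  (kappa n)%:Z - 1 <= k.
Proof.
have [n1|n1] := leqP n 1.
  have -> : n = 1%N by lia.
  by rewrite kappa1; lia.
case: hf => f fM; rewrite leNgt; apply/negP => kk.
by apply: (Morin_not_admissible n1 fM _ (admissible_kappa hn)); lia.
Qed.
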